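(* Let $X$ be a dendrite and let $f\colon X\to X$ be a map. The following are equivalent: (1) $\omega_f$ is continuous and $\overline{\mathrm{Per}(f)}=\bigcap_{n\in\mathbb{N}}f^n(X)$; (2) $\omega(x,f)=\Omega(x,f)$ for every $x\in X$; (3) $f$ is equicontinuous.
   Context: A map is a continuous function, and $\mathbb{N}=\{1,2,3,\dots\}$. A continuum is a nonempty, compact, connected metric space. A dendrite is a locally connected continuum containing no simple closed curve (no homeomorphic copy of the circle). $f^n$ denotes the $n$-th iterate of $f$. A map $f\colon X\to X$ on a metric space $(X,d)$ is equicontinuous if for each $\epsilon>0$ there is $\delta>0$ such that $d(f^n(x),f^n(y))<\epsilon$ for all $n\in\mathbb{N}$ whenever $x,y\in X$ and $d(x,y)<\delta$. $\mathrm{Per}(f)$ is the set of periodic points, i.e. of all $x\in X$ with $f^k(x)=x$ for some $k\in\mathbb{N}$. For $x\in X$: $\omega(x,f)$ is the set of all $y\in X$ for which there is an increasing sequence $(n_i)_{i\in\mathbb{N}}$ in $\mathbb{N}$ with $\lim_{i\to\infty}f^{n_i}(x)=y$; $\Omega(x,f)$ is the set of all $y\in X$ for which there are a sequence $(x_i)_{i\in\mathbb{N}}$ in $X$ converging to $x$ and an increasing sequence $(n_i)_{i\in\mathbb{N}}$ in $\mathbb{N}$ with $\lim_{i\to\infty}f^{n_i}(x_i)=y$. (Increasing means strictly increasing.) $2^X$ is the set of nonempty closed subsets of $X$ with the Hausdorff metric, and $\omega_f\colon X\to 2^X$ is defined by $\omega_f(x)=\omega(x,f)$. *)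

(* Defs.v *)
From HB Require Import structures.
From mathcomp Require Import all_boot all_order all_algebra.
From mathcomp Require Import all_classical all_reals all_analysis.

Set Implicit Arguments.
Unset Strict Implicit.
Unset Printing Implicit Defensive.

Import Order.TTheory GRing.Theory Num.Theory.
Import numFieldNormedType.Exports.

Local Open Scope classical_set_scope.
Local Open Scope ring_scope.

(* Homeomorphism between subsets, with their subspace topologies. The maps are
   total functions on the ambient types, of which only the restrictions to [A]
   and [B] matter. *)
Definition homeomorphic_sets (X Y : topologicalType) (A : set X) (B : set Y) :=
  exists (h : X -> Y) (k : Y -> X),
    [/\ set_fun A B h, {within A, continuous h},
        set_fun B A k, {within B, continuous k}
      & (forall x, A x -> k (h x) = x) /\ (forall y, B y -> h (k y) = y)].

Definition unit_circle (R : realType) : set (R * R) :=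
  [set p | p.1 ^+ 2 + p.2 ^+ 2 = 1].

Definition simple_closed_curve (R : realType) (X : metricType R) (S : set X) :=
  homeomorphic_sets S (@unit_circle R).

Definition locally_connected (X : topologicalType) :=
  forall (x : X) (U : set X), nbhs x U ->
    exists V : set X, [/\ open V, connected V, V x & V `<=` U].

Record is_continuum (R : realType) (X : metricType R) : Prop := IsContinuum {
  continuum_nonempty : [set: X] !=set0 ;
  continuum_compact : compact [set: X] ;
  continuum_connected : connected [set: X]
}.

Record is_dendrite (R : realType) (X : metricType R) : Prop := IsDendrite {
  dendrite_continuum : is_continuum X ;
  dendrite_locally_connected : locally_connected X ;
  dendrite_no_circle : forall S : set X, ~ simple_closed_curve S
}.

Lemma dendrite_compact (R : realType) (X : metricType R) :
  is_dendrite X -> compact [set: X].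
Proof. by move=> /dendrite_continuum/continuum_compact. Qed.

(* The index set of the sequences below is [nat], starting at 0; their values,
   the numbers of iterations, are required to be positive. *)
Definition pos_increasing (n : nat -> nat) :=
  increasing_seq n /\ forall i, (0 < n i)%N.

Definition omega_limit (R : realType) (X : metricType R) (f : X -> X) (x : X) :
    set X :=
  [set y | exists2 n : nat -> nat, pos_increasing n &
     (fun i => iter (n i) f x) @ \oo --> y].

Definition Omega_limit (R : realType) (X : metricType R) (f : X -> X) (x : X) :
    set X :=
  [set y | exists (x_ : nat -> X) (n : nat -> nat),
     [/\ x_ @ \oo --> x, pos_increasing n &
         (fun i => iter (n i) f (x_ i)) @ \oo --> y]].

Definition periodic_points (X : Type) (f : X -> X) : set X :=
  [set x | exists2 k : nat, (0 < k)%N & iter k f x = x].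

Definition equicontinuous_map (R : realType) (X : metricType R) (f : X -> X) :=
  forall e : R, 0 < e -> exists2 d : R, 0 < d &
    forall x y : X, mdist x y < d ->
      forall n : nat, (0 < n)%N -> mdist (iter n f x) (iter n f y) < e.

Section hausdorff_distance.
Context (R : realType) (X : metricType R).
Implicit Types (A B C : set X) (r s : R).

Definition set_nbhd A r : set X := \bigcup_(a in A) ball a r.

Definition hausdorff_radii A B : set R :=
  [set r | [/\ 0 < r, A `<=` set_nbhd B r & B `<=` set_nbhd A r]].

Definition hausdorff_dist A B : R := inf (hausdorff_radii A B).

Lemma hausdorff_radii_sym A B : hausdorff_radii A B = hausdorff_radii B A.
Proof. by apply/seteqP; split=> r [r0 AB BA]; split. Qed.

Lemma hausdorff_radii_lb A B : has_lbound (hausdorff_radii A B).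
Proof. by exists 0 => r [/ltW]. Qed.

Lemma set_nbhdD A B C r s : A `<=` set_nbhd B r -> B `<=` set_nbhd C s ->
  A `<=` set_nbhd C (r + s).
Proof.
move=> AB BC a /AB[b /BC[c Cc cb] ba]; exists c => //.
by rewrite addrC; exact: ball_triangle cb ba.
Qed.

Lemma hausdorff_radiiD A B C r s : hausdorff_radii A B r ->
  hausdorff_radii B C s -> hausdorff_radii A C (r + s).
Proof.
move=> [r0 AB BA] [s0 BC CB]; split; first exact: addr_gt0.
- exact: set_nbhdD AB BC.
- by rewrite addrC; exact: set_nbhdD CB BA.
Qed.

Hypothesis cX : compact [set: X].

Lemma compact_bounded_metric (x0 : X) : exists n : nat, [set: X] `<=` ball x0 n%:R.
Proof.
have [n _ /(_ n (leqnn n))] :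
    \forall n \near \oo, [set: X] `<=` (fun x => ball x0 n%:R x).
  move/compact_near_coveringP : cX; apply => x _.
  exists (ball x 1, [set n | (Num.truncn (mdist x0 x + 1) < n)%N]) => /=.
    by split; [exact: nbhsx_ballx|exists (Num.truncn (mdist x0 x + 1)).+1].
  move=> [y n] [/= xy nlt]; rewrite ballEmdist /=.
  apply: (le_lt_trans (metric_triangle _ x _)).
  have d1 : mdist x y < 1 by move: xy; rewrite ballEmdist.
  apply: (@lt_trans _ _ (mdist x0 x + 1)); first by rewrite ltrD2l.
  apply: (@lt_le_trans _ _ (Num.truncn (mdist x0 x + 1)).+1%:R).
    exact: Num.Theory.truncnS_gt.
  by rewrite ler_nat.
by move=> nX; exists n.
Qed.

Lemma hausdorff_radii_nonempty A B : A !=set0 -> B !=set0 ->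
  hausdorff_radii A B !=set0.
Proof.
move=> [a Aa] [b Bb].
have [n nX] := compact_bounded_metric a; have [m mX] := compact_bounded_metric b.
exists (n%:R + m%:R + 1); split.
- by rewrite ltr_wpDl// addr_ge0.
- move=> x _; exists b => //; apply: le_ball (mX x I).
  by rewrite -addrA addrCA lerDl addr_ge0.
- move=> x _; exists a => //; apply: le_ball (nX x I).
  by rewrite -addrA lerDl addr_ge0.
Qed.

Lemma hausdorff_radii_inf A B e : A !=set0 -> B !=set0 -> 0 < e ->
  exists2 r, hausdorff_radii A B r & r < hausdorff_dist A B + e.
Proof.
move=> A0 B0 e0; apply: inf_adherent => //; split.
  exact: hausdorff_radii_nonempty.
exact: hausdorff_radii_lb.
Qed.

Lemma hausdorff_distxx A : A !=set0 -> hausdorff_dist A A = 0.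
Proof.
move=> A0; apply/eqP; rewrite eq_le; apply/andP; split.
  apply/ler_addgt0Pl => e e0; rewrite addr0; apply: ge_inf.
    exact: hausdorff_radii_lb.
  by split=> // a Aa; exists a => //; exact: ballxx.
apply: lb_le_inf; first exact: hausdorff_radii_nonempty.
by move=> r [/ltW].
Qed.

Lemma hausdorff_dist_sym A B : hausdorff_dist A B = hausdorff_dist B A.
Proof. by rewrite /hausdorff_dist hausdorff_radii_sym. Qed.

Lemma hausdorff_dist_sub A B : A !=set0 -> B !=set0 -> closed B ->
  hausdorff_dist A B = 0 -> A `<=` B.
Proof.
move=> A0 B0 cB AB0 a Aa; apply: cB => U /nbhs_ballP[e /= e0 eU].
have [r [_ AB _]] := hausdorff_radii_inf A0 B0 e0.
rewrite AB0 add0r => re; have [b Bb ba] := AB a Aa.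
exists b; split=> //; apply: eU; apply: ball_sym.
exact: le_ball (ltW re) _ ba.
Qed.

Lemma hausdorff_dist_triangle B A C : A !=set0 -> B !=set0 -> C !=set0 ->
  hausdorff_dist A C <= hausdorff_dist A B + hausdorff_dist B C.
Proof.
move=> A0 B0 C0; apply/ler_addgt0Pr => e e0.
have e20 : 0 < e / 2 by rewrite divr_gt0.
have [r ABr rlt] := hausdorff_radii_inf A0 B0 e20.
have [s BCs slt] := hausdorff_radii_inf B0 C0 e20.
apply: (@le_trans _ _ (r + s)).
  by apply: ge_inf; [exact: hausdorff_radii_lb|exact: hausdorff_radiiD BCs].
by rewrite [e]splitr addrACA lerD// ltW.
Qed.

End hausdorff_distance.

(* The hyperspace 2^X of a compact metric space X. Compactness is an argument of
   the type because it makes the Hausdorff distance finite, hence a metric. *)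
Record hyperspace (R : realType) (X : metricType R) (cX : compact [set: X]) :=
  Hyperspace {
    hyperspace_set :> set X ;
    hyperspace_nonempty : hyperspace_set !=set0 ;
    hyperspace_closed : closed hyperspace_set
  }.

Section hyperspace_metric.
Context (R : realType) (X : metricType R) (cX : compact [set: X]).

HB.instance Definition _ := gen_eqMixin (hyperspace cX).
HB.instance Definition _ := gen_choiceMixin (hyperspace cX).

Let dist (A B : hyperspace cX) : R := hausdorff_dist A B.

Let distxx A : dist A A = 0.
Proof. exact/hausdorff_distxx/hyperspace_nonempty. Qed.

Let dist_positivity A B : dist A B = 0 -> A = B.
Proof.
case: A B => [A A0 cA] [B B0 cB]; rewrite /dist/= => AB0.
have AB : A = B.
  apply/seteqP; split; first exact: (hausdorff_dist_sub cX A0 B0 cB AB0).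
  by apply: (hausdorff_dist_sub cX B0 A0 cA); rewrite hausdorff_dist_sym.
by subst B; congr Hyperspace; exact: Prop_irrelevance.
Qed.

Let dist_sym A B : dist A B = dist B A.
Proof. exact: hausdorff_dist_sym. Qed.

Let dist_triangle B A C : dist A C <= dist A B + dist B C.
Proof. by apply: hausdorff_dist_triangle => //; exact: hyperspace_nonempty. Qed.

HB.instance Definition _ := @isMetric.Build R (hyperspace cX) dist
  distxx dist_positivity dist_sym dist_triangle.

Lemma hyperspace_mdistE (A B : hyperspace cX) :
  mdist A B = hausdorff_dist A B.
Proof. by []. Qed.

End hyperspace_metric.

Section omega_map.
Context (R : realType) (X : metricType R) (cX : compact [set: X]).

Lemma omega_limitE (f : X -> X) (x : X) :
  omega_limit f x = cluster ((fun n => iter n f x) @ \oo).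
Proof.
apply/seteqP; split=> [y [n [incn n0] ny] A B [N _ NA] yB|y cy].
  have [M _ MB] := ny _ yB.
  have nge i : (i <= n i)%N.
    elim: i => // i IH; apply: leq_ltn_trans IH _.
    by have /increasing_seqP := incn; exact.
  exists (iter (n (maxn N M)) f x); split.
    by apply: NA => /=; apply: leq_trans (nge _); exact: leq_maxl.
  by apply: MB => /=; exact: leq_maxr.
have H (p : nat * nat) : exists m : nat,
    (p.2 < m)%N /\ ball y p.1.+1%:R^-1 (iter m f x).
  have [||z [[m pm <-] ?]] := cy ((fun m => iter m f x) @` [set m | (p.2 < m)%N])
      (ball y p.1.+1%:R^-1).
  - by exists p.2.+1 => // m /= ?; exists m.
  - by apply: nbhsx_ballx; rewrite invr_gt0.
  - by exists m.
have [g gP] := choice H.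
pose n := fix n i := if i is j.+1 then g (i, n j) else g (0, 0)%N.
have nS i : (n i < n i.+1)%N by have [] := gP (i.+1, n i).
have ny i : ball y i.+1%:R^-1 (iter (n i) f x).
  by case: i => [|i]; [have [] := gP (0, 0)%N|have [] := gP (i.+1, n i)].
exists n; first split.
- exact/increasing_seqP.
- case=> [|i]; first by have [] := gP (0, 0)%N.
  exact: leq_ltn_trans (nS i).
- apply/cvg_ballP => e e0; near=> i.
  apply: le_ball (ny i); apply/ltW; near: i.
  exact: (near_infty_natSinv_lt (PosNum e0)).
Unshelve. all: by end_near. Qed.

Lemma omega_limit_nonempty (f : X -> X) (x : X) : omega_limit f x !=set0.
Proof.
have /cX : ((fun n => iter n f x) @ \oo) [set: X] by exact: filterT.
by move=> [y [_ cy]]; exists y; rewrite omega_limitE.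
Qed.

Lemma omega_limit_closed (f : X -> X) (x : X) : closed (omega_limit f x).
Proof.
rewrite omega_limitE clusterE; apply: closed_bigI => A _.
exact: closed_closure.
Qed.

Definition omega_map (f : X -> X) (x : X) : hyperspace cX :=
  @Hyperspace R X cX (omega_limit f x)
    (@omega_limit_nonempty f x) (@omega_limit_closed f x).

End omega_map.

(* Main.v *)
Require Import Defs.
From mathcomp Require Import all_boot all_order all_algebra.
From mathcomp Require Import all_classical all_reals all_analysis.
From mathcomp Require Import ring lra zify.
Import Order.TTheory GRing.Theory Num.Theory.
Import numFieldNormedType.Exports.
Local Open Scope classical_set_scope.

(** In a dendrite two points [a] and [b] are joined by exactly one arc, and this
arc is the least continuum containing them, written [between a b] below. The
arcs issuing from a base point [p] order the dendrite: [x] is at most [y] when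
[x] lies on the arc from [p] to [y]. Everything about dendrites that the proof
needs is read off this order.

To obtain it, chains of points with shorter and shorter steps are made to
converge to a path ([path_near_connected]), the loops of the path are cut off
([path_monotone]), and the result is reparametrized injectively
([monotone_path_arc]). The arcs so obtained stay near any prescribed connected
set that contains their endpoints. If an arc had a point outside a continuum [C]
containing its endpoints, a second arc with these endpoints, following [C],
would avoid that point, and pieces of the two arcs would form a circle
([arc_sub_continuum]). The order is closed and has connected intervals, so a
maximal point among those that a map moves away from a base point is a fixed
point of the map ([dendrite_fixed_point]).

The condition that [omega_limit f x] is [Omega_limit f x] for all [x] is the
centre of the equivalence. It makes the relation of being a limit point closed,
so that limit sets are minimal, depend continuously on the point, and contain
the point itself when it belongs to the intersection of the images of [f].
Its main consequence is [not_moved_away]: if [p] is fixed, no point [x] lies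
strictly between [p] and [iter k f x], since otherwise a backward orbit of [x]
would descend along the arc to a fixed point [q] of [iter k f] with [x] in
[Omega_limit f q], that is, in the orbit of [q].

If equicontinuity fails, the images of arbitrarily small continua join points
near two distinct points [a] and [b] of a limit set. Hence they contain every
point [c] between [a] and [b], and [c] belongs to the same limit set. The orbit
of [c] comes back close to [a] and to [b], one of which lies beyond [c] as seen
from a fixed point, which [not_moved_away] forbids. In the same way, a point
between a fixed point and a point of the intersection of the images is periodic,
because recurrence would otherwise move it away. So periodic points are dense in
that intersection.

In the other direction, a periodic point belongs to its own limit set; when the
limit set varies continuously, this passes to the closure of the set of periodic
points, and so does the equality of the limit sets of [z] and [iter n f z], which
places each point of [Omega_limit f x] in [omega_limit f x]. *)

Set Implicit Arguments.
Unset Strict Implicit.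
Unset Printing Implicit Defensive.

(** * Metric characterizations and chains *)

Section metric_characterizations.
Context (R : realType) (X : metricType R).
Local Open Scope ring_scope.

Lemma mdist_lt_le_trans (x y z : X) (d e : R) :
  mdist x y < d -> mdist y z < e -> mdist x z < d + e.
Proof. by move=> xy yz; apply: le_lt_trans (metric_triangle x y z) _; lra. Qed.

Lemma mdist_eq0P (x y : X) : (forall e, 0 < e -> mdist x y < e) -> x = y.
Proof.
move=> H; apply: contrapT => xy.
have /H : 0 < mdist x y by rewrite mdist_gt0; apply/eqP.
by rewrite ltxx.
Qed.

Lemma continuous_mdistP (Y : metricType R) (f : X -> Y) :
  continuous f <-> forall x e, 0 < e -> exists2 d, 0 < d &
    forall y, mdist x y < d -> mdist (f x) (f y) < e.
Proof.
split=> [cf x e e0|H x].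
  have /metricType_numDomainType.cvgrPdist_lt/(_ e e0)/nbhs_ballP[d /= d0 dP] := cf x.
  by exists d => // y; have := dP y; rewrite ballEmdist.
apply/metricType_numDomainType.cvgrPdist_lt => e /(H x)[d d0 dP]; apply/nbhs_ballP.
by exists d => //= y; rewrite ballEmdist; exact: dP.
Qed.

Lemma continuous_realP (g : R -> X) :
  continuous g <-> forall t e, 0 < e -> exists2 d, 0 < d &
    forall s, `|t - s| < d -> mdist (g t) (g s) < e.
Proof.
split=> [cf x e e0|H x].
  have /metricType_numDomainType.cvgrPdist_lt/(_ e e0)/nbhs_ballP[d /= d0 dP] := cf x.
  by exists d => // y; have := dP y.
apply/metricType_numDomainType.cvgrPdist_lt => e /(H x)[d d0 dP].
by apply/nbhs_ballP; exists d.
Qed.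

Lemma cvg_mdistP (u : nat -> X) (l : X) : u @ \oo --> l <->
  forall e, 0 < e -> exists N, forall n, (N <= n)%N -> mdist l (u n) < e.
Proof.
split=> [/metricType_numDomainType.cvgrPdist_lt ul e /ul[N _ NP]|H]; first by exists N.
by apply/metricType_numDomainType.cvgrPdist_lt => e /H[N NP]; exists N.
Qed.

Lemma closed_mdistP (A : set X) : closed A <->
  forall x, (forall e, 0 < e -> exists2 y, A y & mdist x y < e) -> A x.
Proof.
split=> [cA x H|H x Ax].
  apply: cA => B /nbhs_ballP[e /= /H[y Ay xy] eB].
  by exists y; split=> //; apply: eB; rewrite ballEmdist.
apply: H => e e0; have [y [Ay]] := Ax _ (nbhsx_ballx x e e0).
by rewrite ballEmdist; exists y.
Qed.

Lemma open_mdistP (A : set X) (x : X) : open A -> A x ->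
  exists2 e, 0 < e & forall y, mdist x y < e -> A y.
Proof.
move=> oA Ax; have /nbhs_ballP[e /= e0 eA] : nbhs x A by exact: open_nbhs_nbhs.
by exists e => // y; have := eA y; rewrite ballEmdist.
Qed.

Lemma nbhs_mdistP (A : set X) (x : X) : nbhs x A <->
  exists2 e, 0 < e & forall y, mdist x y < e -> A y.
Proof.
split=> [/nbhs_ballP[e /= e0 eA]|[e e0 eA]].
  by exists e => // y; have := eA y; rewrite ballEmdist.
by apply/nbhs_ballP; exists e => //= y; rewrite ballEmdist; exact: eA.
Qed.

Lemma closed_away (A : set X) (x : X) : closed A -> ~ A x ->
  exists2 e, 0 < e & forall y, A y -> e <= mdist x y.
Proof.
move=> /closed_openC cA /(open_mdistP cA)[e e0 eA]; exists e => // y Ay.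
by rewrite leNgt; apply/negP => /eA.
Qed.

Lemma compact_cluster_seq (u : nat -> X) : compact [set: X] ->
  exists x, forall e N, 0 < e -> exists2 n, (N <= n)%N & mdist x (u n) < e.
Proof.
move=> cX; have /cX : (u @ \oo) [set: X] by exact: filterT.
move=> [x [_ xu]]; exists x => e N e0.
have [||y [[n Nn <-]]] := xu (u @` [set n | (N <= n)%N]) (ball x e).
- by exists N => // n /= Nn; exists n.
- exact: nbhsx_ballx.
- by rewrite ballEmdist; exists n.
Qed.

End metric_characterizations.

Section connectedness.
Context (R : realType) (X : metricType R).
Local Open Scope ring_scope.

(** The points of a connected set that chains of short steps reach from [x]
form a subset that is open and closed in it. *)
Lemma connected_chain (S : set X) (x y : X) (d : R) :
  connected S -> S x -> S y -> 0 < d ->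
  exists n (s : nat -> X), [/\ s 0 = x, forall i, (n <= i)%N -> s i = y,
    forall i, S (s i) & forall i, mdist (s i) (s i.+1) < d].
Proof.
move=> cS Sx Sy d0.
pose P z := exists n (s : nat -> X), [/\ s 0 = x,
  forall i, (n <= i)%N -> s i = z,
  forall i, S (s i) & forall i, mdist (s i) (s i.+1) < d].
have step z w : P z -> S w -> mdist z w < d -> P w.
  move=> [n [s [s0 sn sS sd]]] Sw zw.
  exists n.+1, (fun i => if (i <= n)%N then s i else w); split => //.
  - by move=> i ni; rewrite leqNgt ni.
  - by move=> i; case: ifP.
  - move=> i; have [ilt|ige] := leqP i.+1 n; first by rewrite (ltnW ilt).
    case: ifP => [ile|_]; last by rewrite mdistxx.
    by rewrite sn// .
have PS z : P z -> S z by move=> [n [s [_ sn sS _]]]; rewrite -(sn n).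
suff PSE : [set z | P z] = S by have /= : [set z | P z] y by rewrite PSE.
have xP : P x.
  by exists 0%N, (fun=> x); split => // i; rewrite mdistxx.
apply: cS; first by exists x.
- exists (\bigcup_(z in [set z | P z]) (ball z d)°).
    by apply: bigcup_open => z _; exact: open_interior.
  apply/seteqP; split=> [z /= Pz|w [Sw [z /= Pz /interior_subset]]].
    by split; [exact: PS|exists z => //; exact: nbhsx_ballx].
  by rewrite ballEmdist; exact: step.
- exists (closure [set z | P z]); first exact: closed_closure.
  apply/seteqP; split=> [z /= Pz|w [Sw clw]].
    by split; [exact: PS|exact: subset_closure].
  have [] := clw (ball w d); first exact: nbhsx_ballx.
  by move=> z [/= Pz]; rewrite ballEmdist /= metric_sym; exact: step.
Qed.

(** Local connectedness is uniform on a compact space: pairs of points at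
distance tending to [0] accumulate at one point, and a connected neighbourhood
of this point contains some of the pairs. *)
Lemma compact_uniform_connected (e : R) : compact [set: X] ->
  locally_connected X -> 0 < e -> exists2 d, 0 < d &
    forall x y : X, mdist x y < d -> exists S, [/\ connected S, S x, S y &
      forall z, S z -> mdist x z < e].
Proof.
move=> cX lc e0; apply: contrapT => H.
have /choice[u uP] : forall n : nat, exists p : X * X,
    mdist p.1 p.2 < n.+1%:R^-1 /\ ~ exists S, [/\ connected S, S p.1, S p.2 &
      forall z, S z -> mdist p.1 z < e].
  move=> n; apply: contrapT => Hn; apply: H; exists n.+1%:R^-1.
    by rewrite invr_gt0.
  move=> x y xy; apply: contrapT => nS; apply: Hn.
  by exists (x, y).
have [x xu] := compact_cluster_seq (fst \o u) cX.
have e20 : 0 < e / 2 by rewrite divr_gt0.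
have [V [oV cV Vx VE]] := lc x _ (nbhsx_ballx x _ e20).
have [r r0 rV] := open_mdistP oV Vx.
have r20 : 0 < r / 2 by rewrite divr_gt0.
have [N _ Nr] := near_infty_natSinv_lt (PosNum r20).
have [n Nn /= xun] := xu _ N r20.
have [un] := uP n; apply.
have {}un := lt_trans un (Nr n Nn).
exists V; split => //.
- by apply: rV; lra.
- by apply: rV; rewrite [r]splitr; exact: mdist_lt_le_trans un.
- move=> z /VE; rewrite ballEmdist /= => xz.
  rewrite [e]splitr; apply: mdist_lt_le_trans xz.
  have := VE (u n).1; rewrite ballEmdist /= metric_sym; apply.
  by apply: rV; lra.
Qed.

End connectedness.

(** * Paths in locally connected compact spaces *)

Section reals.
Context (R : realType).
Local Open Scope ring_scope.

Lemma truncn_divn (y : R) (N : nat) : (0 < N)%N ->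
  (Num.truncn (y * N%:R) %/ N)%N = Num.truncn y.
Proof.
move=> N0; have N0R : 0 < N%:R :> R by rewrite ltr0n.
have [y0|y0] := ltP y 0.
  have z (x : R) : x < 0 -> Num.truncn x = 0%N.
    by move=> x0; apply/truncn0Pn; rewrite -ltNge; lra.
  by rewrite !z// ?div0n// mulrC pmulr_rlt0.
apply/esym/truncn_def.
have /truncn_itv/andP[] : 0 <= y * N%:R by rewrite mulr_ge0// ler0n.
set q := Num.truncn _ => ql qu; apply/andP; split.
  rewrite -(ler_pM2r N0R); apply: le_trans ql.
  by rewrite -natrM ler_nat leq_trunc_div.
rewrite -(ltr_pM2r N0R); apply: lt_le_trans qu _.
by rewrite -natrM ler_nat ltn_ceil.
Qed.

Lemma truncn_close (x y : R) : `|x - y| < 1 ->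
  (Num.truncn y <= (Num.truncn x).+1)%N.
Proof.
move=> xy; rewrite truncn_le_nat.
have := truncnS_gt x; rewrite -[(_.+2)%:R]natr1 => xt.
by have := ler_norm (y - x); rewrite distrC; lra.
Qed.

Lemma geometric_small (c d : R) : 0 < d -> exists k : nat, c / 2 ^+ k < d.
Proof.
move=> d0; exists (Num.truncn (c / d)).+1; set k := (Num.truncn _).+1.
have p0 : 0 < 2 ^+ k :> R by rewrite exprn_gt0.
suff : c / d < 2 ^+ k by rewrite !ltr_pdivrMr// (mulrC d).
apply: lt_le_trans (truncnS_gt (c / d)) _.
by rewrite -/k -natrX ler_nat ltnW// ltn_expl.
Qed.

End reals.

Section paths.
Context (R : realType) (X : metricType R).
Local Open Scope ring_scope.

(** Paths are parametrized by the whole line and constant outside the unit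
interval, which spares continuity on a subspace. *)
Definition path_from_to (a b : X) (g : R -> X) :=
  [/\ continuous g, forall t, t <= 0 -> g t = a & forall t, 1 <= t -> g t = b].

(** One refinement step towards a path. All links are replaced by chains of the
same number [N] of points, so that the refined chain is again evenly
parametrized. *)
Lemma chain_refine (a b : X) (m : nat)
    (s : nat -> X) (d d' e : R) : 0 < d' ->
  (forall x y : X, mdist x y < d -> exists S, [/\ connected S, S x, S y &
      forall z, S z -> mdist x z < e]) ->
  (0 < m)%N -> s 0 = a -> (forall i, (m <= i)%N -> s i = b) ->
  (forall i, mdist (s i) (s i.+1) < d) ->
  exists N (s' : nat -> X), [/\ (0 < N)%N, s' 0 = a,
    forall i, (m * N <= i)%N -> s' i = b,
    forall i, mdist (s' i) (s' i.+1) < d' &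
    forall i, mdist (s (i %/ N)%N) (s' i) < e].
Proof.
move=> d'0 dP m0 s0 sm sd.
have /choice[n] : forall i, exists n, exists c : nat -> X,
   [/\ c 0 = s i, forall j, (n <= j)%N -> c j = s i.+1,
     forall j, mdist (c j) (c j.+1) < d' & forall j, mdist (s i) (c j) < e].
  move=> i; have [S [cS Si Si1 Se]] := dP _ _ (sd i).
  have [n [c [c0 cn cc cd]]] := connected_chain cS Si Si1 d'0.
  by exists n, c; split => // j; apply: Se.
move=> /choice[c] cP.
(* One more than the length of the longest chain: each chain has reached its last
   point before the next one starts. *)
pose N := (\max_(i < m) n i).+1.
have nN i : (i < m)%N -> (n i < N)%N.
  by move=> im; rewrite ltnS (leq_bigmax (Ordinal im)).
pose s' q := if (q < m * N)%N then c (q %/ N)%N (q %% N)%N else b.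
have e0 : 0 < e.
  by have [_ _ _ /(_ 0%N)] := cP 0%N; apply: le_lt_trans; exact: mdist_ge0.
exists N, s'; split => //.
- by rewrite /s' muln_gt0 m0 /= div0n mod0n; have [->] := cP 0%N.
- by move=> i mi; rewrite /s' ltnNge mi.
- move=> q; rewrite /s'.
  have [qm|qm] := ltnP q (m * N)%N; last first.
    by rewrite ltnNge (leq_trans qm)//= mdistxx.
  have qNm : (q %/ N < m)%N by rewrite ltn_divLR.
  have [c0 cn cd _] := cP (q %/ N)%N.
  have [qN|qN] := ltnP (q %% N)%N.+1 N.
    have E : q.+1 = (q %/ N * N + (q %% N)%N.+1)%N by rewrite addnS -divn_eq.
    have -> : (q.+1 %/ N = q %/ N)%N by rewrite E divnMDl// (divn_small qN) addn0.
    have -> : (q.+1 %% N = (q %% N)%N.+1)%N by rewrite {1}E modnMDl modn_small.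
    have -> : (q.+1 < m * N)%N.
      by rewrite E; apply: leq_trans (_ : (q %/ N)%N.+1 * N <= _)%N;
        [rewrite mulSn addnC ltn_add2r|rewrite leq_mul2r qNm orbT].
    exact: cd.
  have E : q.+1 = ((q %/ N)%N.+1 * N)%N.
    rewrite mulSn {1}(divn_eq q N) -addnS addnC; congr (_ + _)%N.
    by apply/eqP; rewrite eqn_leq qN andbT ltn_mod.
  have -> : c (q %/ N)%N (q %% N)%N = s (q %/ N)%N.+1.
    by apply: cn; rewrite -ltnS; apply: leq_trans (nN _ qNm) qN.
  rewrite E ltn_pmul2r//; case: ltnP => [lt|ge].
    by rewrite mulnK// modnMl; have [->] := cP (q %/ N)%N.+1; rewrite mdistxx.
  by rewrite sm// mdistxx.
- move=> q; rewrite /s'; case: ltnP => [qm|qm].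
    by have [_ _ _] := cP (q %/ N)%N; apply.
  by rewrite sm ?mdistxx// leq_divRL.
Qed.

(** Step functions along successively refined chains converge uniformly, and their
jumps tend to [0], so the limit is continuous. *)
Lemma path_near_connected (S : set X) (a b : X) (e : R) :
  compact [set: X] -> locally_connected X -> connected S -> S a -> S b ->
  0 < e -> exists2 g : R -> X, path_from_to a b g &
    forall t, exists2 z, S z & mdist z (g t) < e.
Proof.
move=> cX lc cS Sa Sb e0.
(* The level [k] moves points by less than [ep k], in total by at most [e / 4]. *)
pose ep (k : nat) : R := e / 8 / 2 ^+ k.
have ep0 k : 0 < ep k by rewrite !divr_gt0// exprn_gt0.
have epS k : ep k = ep k.+1 *+ 2.
  by rewrite /ep exprS invfM mulrCA -mulrnAr -[X in X * _]mulr1; field.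
have /choice[D DP] : forall k, exists d : R, [/\ 0 < d, d <= ep k &
    forall x y : X, mdist x y < d -> exists S, [/\ connected S, S x, S y &
      forall z, S z -> mdist x z < ep k]].
  move=> k; have [d d0 dP] := compact_uniform_connected cX lc (ep0 k).
  exists (Num.min d (ep k)); split; first by rewrite lt_min d0 ep0.
    by rewrite ge_min lexx orbT.
  by move=> x y; rewrite lt_min => /andP[/dP].
pose Q k (p : nat * (nat -> X)) := [/\ (0 < p.1)%N, p.2 0%N = a,
  forall i, (p.1 <= i)%N -> p.2 i = b & forall i, mdist (p.2 i) (p.2 i.+1) < D k].
pose next k (p p' : nat * (nat -> X)) := exists N, [/\ (0 < N)%N,
  p'.1 = (p.1 * N)%N & forall i, mdist (p.2 (i %/ N)%N) (p'.2 i) < ep k].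
have [D00 _ _] := DP 0%N.
have [n0 [s0 [s00 s0n s0S s0d]]] := connected_chain cS Sa Sb D00.
have Q0 : Q 0%N (n0.+1, s0) by split => // i /ltnW; exact: s0n.
have /choice[F FP] : forall kp : nat * (nat * (nat -> X)), exists p',
    Q kp.1 kp.2 -> Q kp.1.+1 p' /\ next kp.1 kp.2 p'.
  move=> [k [m s]]; have [|nQ] := pselect (Q k (m, s)); last by exists (m, s).
  move=> [/= m0 sa sb sd].
  have [_ _ dP] := DP k; have [d'0 _ _] := DP k.+1.
  have [N [s' [N0 ? ? ? ss']]] := chain_refine d'0 dP m0 sa sb sd.
  exists ((m * N)%N, s') => _; split; last by exists N.
  by split => //=; rewrite muln_gt0 m0.
pose L := fix L k := if k is j.+1 then F (j, L j) else (n0.+1, s0).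
have QL k : Q k (L k) by elim: k => // k IH; have [] := FP (k, L k) IH.
have nextL k : next k (L k) (L k.+1) by have [] := FP (k, L k) (QL k).
pose g (k : nat) (t : R) : X := (L k).2 (Num.truncn (t * (L k).1%:R)).
have gS k t : mdist (g k t) (g k.+1 t) < ep k.
  have [N [N0 LN NP]] := nextL k; rewrite /g LN natrM mulrA.
  by have := NP (Num.truncn (t * (L k).1%:R * N%:R)); rewrite truncn_divn.
have gD k j t : mdist (g k t) (g (k + j)%N t) <= (ep k - ep (k + j)%N) *+ 2.
  elim: j => [|j IH]; first by rewrite addn0 mdistxx subrr mul0rn.
  apply: le_trans (metric_triangle _ (g (k + j)%N t) _) _.
  have := gS (k + j)%N t; have := epS (k + j)%N; rewrite addnS.
  by rewrite !mulr2n in IH *; lra.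
have /choice[G GP] : forall t, exists p, forall k, mdist (g k t) p <= ep k *+ 2.
  move=> t; have [p pP] := compact_cluster_seq (g^~ t) cX.
  exists p => k; apply/ler_addgt0Pr => h h0; have [n kn nh] := pP _ k h0.
  apply: le_trans (metric_triangle _ (g n t) _) _.
  have := gD k (n - k)%N t; rewrite subnKC// !mulr2n (metric_sym (g n t)).
  by have := ep0 n; lra.
have Gcst t x : (forall k, g k t = x) -> G t = x.
  move=> gx; apply/esym/mdist_eq0P => h h0.
  have [k kh] := geometric_small (e / 8) (divr_gt0 h0 (ltr0n R 2)).
  rewrite -/(ep k) in kh.
  by have := GP t k; rewrite gx (mulr2n (ep k)) => ?; lra.
exists G; first split.
- apply/continuous_realP => t h h0.
  have [k kh] := geometric_small (e / 8) (divr_gt0 h0 (ltr0n R 5)).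
  rewrite -/(ep k) in kh; have [m0 _ _ sd] := QL k.
  have m0R : 0 < (L k).1%:R :> R by rewrite ltr0n.
  exists (L k).1%:R^-1; first by rewrite invr_gt0.
  move=> s ts.
  have tsm : `|t * (L k).1%:R - s * (L k).1%:R| < 1.
    by rewrite -mulrBl normrM (gtr0_norm m0R) -ltr_pdivlMr// div1r.
  have gts : mdist (g k t) (g k s) < ep k.
    have [_ De _] := DP k; apply: lt_le_trans De.
    have := truncn_close tsm; rewrite distrC in tsm; have := truncn_close tsm.
    rewrite /g; set i := Num.truncn _; set j := Num.truncn _ => ij ji.
    have [->|->|->] : [\/ i = j, i = j.+1 | j = i.+1].
      have [<-|] := eqVneq i j; first by constructor 1.
      rewrite neq_ltn => /orP[] lt; [constructor 3|constructor 2];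
        by apply/eqP; rewrite eqn_leq lt andbT.
    + by rewrite mdistxx; have [] := DP k.
    + by rewrite metric_sym.
    + exact: sd.
  apply: le_lt_trans (metric_triangle _ (g k t) _) _.
  apply: (@le_lt_trans _ _
    (mdist (G t) (g k t) + (mdist (g k t) (g k s) + mdist (g k s) (G s)))).
    by rewrite lerD2l metric_triangle.
  have := GP t k; have := GP s k; rewrite (metric_sym (G t)) !mulr2n.
  lra.
- move=> t t0; apply: Gcst => k; rewrite /g.
  have [m0 sa _ _] := QL k.
  suff -> : Num.truncn (t * (L k).1%:R) = 0%N by [].
  apply/eqP; rewrite -leqn0 truncn_le_nat.
  by apply: le_lt_trans (_ : 0 < _) => //; rewrite mulr_le0_ge0// ler0n.
- move=> t t1; apply: Gcst => k; rewrite /g.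
  have [m0 _ sb _] := QL k; apply: sb.
  have mt : (L k).1%:R <= t * (L k).1%:R by rewrite ler_peMl// ler0n.
  by rewrite truncn_ge_nat//; apply: le_trans mt; rewrite ler0n.
- move=> t; exists (g 0%N t); first exact: s0S.
  by apply: le_lt_trans (GP t 0%N) _; rewrite /ep expr0 mulr2n; lra.
Qed.

End paths.

(** * Cutting off the loops of a path *)

Section closed_sets_of_reals.
Context (R : realType).
Local Open Scope ring_scope.

Lemma closed_last_point (K : set R) (t : R) : closed K ->
  (exists2 s, s <= t & K s) ->
  exists m, [/\ m <= t, K m & forall s, s <= t -> K s -> s <= m].
Proof.
move=> cK [s0 s0t Ks0]; pose A := [set s | s <= t /\ K s].
have hA : has_sup A by split; [exists s0|exists t => s []].
exists (sup A); split.
- by apply: ge_sup => [|s []//]; exists s0.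
- apply: cK => B /nbhs_ballP[e /= e0 eB].
  have [s [st Ks] es] := sup_adherent e0 hA.
  exists s; split=> //; apply: eB; rewrite /ball /=.
  have : s <= sup A by apply: sup_upper_bound.
  by move=> ?; rewrite ger0_norm; lra.
- by move=> s st Ks; apply: sup_upper_bound.
Qed.

Lemma closed_first_point (K : set R) (t : R) : closed K ->
  (exists2 s, t <= s & K s) ->
  exists m, [/\ t <= m, K m & forall s, t <= s -> K s -> m <= s].
Proof.
move=> cK [s0 s0t Ks0].
have cNK : closed [set s | K (- s)].
  by apply: (@closed_comp _ _ (fun x : R => - x)) => // x _; exact: opp_continuous.
have [|m [mt Km mP]] := closed_last_point (t := - t) cNK.
  by exists (- s0); rewrite /= ?opprK// lerN2.
exists (- m); split => //; first by lra.
move=> s ts Ks; suff : - s <= m by lra.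
by apply: mP; rewrite /= ?opprK//; lra.
Qed.

End closed_sets_of_reals.

Section monotone_path.
Context (R : realType) (X : metricType R).
Local Open Scope ring_scope.

(** The set of times kept after loops of the path [g] have been cut off: [g] is at
the same point before and after each open interval of deleted times. *)
Definition agrees_across_gaps (g : R -> X) (K : set R) :=
  [/\ closed K, forall t, t <= 0 \/ 1 <= t -> K t &
    forall s t, s < t -> K s -> K t ->
      (forall u, s < u -> u < t -> ~ K u) -> g s = g t].

(** A gap of the intersection of a chain of such sets need not be a gap of any of
them, but by compactness every shorter closed interval is contained in a gap of
one of them. *)
Lemma agrees_across_gaps_chain (g : R -> X) (F : set (set R)) :
  continuous g ->
  F `<=` [set V | agrees_across_gaps g (~` V)] -> total_on F subset ->
  agrees_across_gaps g (~` \bigcup_(V in F) V).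
Proof.
move=> /continuous_realP cg FP Ft; split.
- rewrite setC_bigcup; apply: closed_bigI => V FV; by have [] := FP V FV.
- by move=> t t01 [V FV Ot]; have [_ /(_ t t01)] := FP V FV.
- move=> s t st Ks Kt gap; apply: mdist_eq0P => e e0.
  have e20 : 0 < e / 2 by rewrite divr_gt0.
  have [ds ds0 dsP] := cg s _ e20; have [dt dt0 dtP] := cg t _ e20.
  (* Within [h] of [s] and [t] the path moves by less than [e / 2], and the points
     [s + h] and [t - h] remain in order. *)
  pose h := Num.min (Num.min ds dt) ((t - s) / 2) / 2.
  have [h0 hds hdt hst] : [/\ 0 < h, h < ds, h < dt & s + h < t - h].
    have mds : Num.min (Num.min ds dt) ((t - s) / 2) <= ds.
      by rewrite !ge_min lexx.
    have mdt : Num.min (Num.min ds dt) ((t - s) / 2) <= dt.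
      by rewrite !ge_min lexx orbT.
    have mst : Num.min (Num.min ds dt) ((t - s) / 2) <= (t - s) / 2.
      by rewrite !ge_min lexx !orbT.
    have m0 : 0 < Num.min (Num.min ds dt) ((t - s) / 2).
      by rewrite !lt_min ds0 dt0 /= divr_gt0// subr_gt0.
    by rewrite /h; split; lra.
  have cover x : s + h <= x <= t - h -> exists2 V, F V & V x.
    move=> /andP[sx xt]; have /contrapT[V FV Vx] : ~ ~ (\bigcup_(V in F) V) x.
      by apply: gap; lra.
    by exists V.
  have [V FV Ocov] : exists2 V, F V & `[s + h, t - h] `<=` V.
    pose B (V : set R) : set (set R) := [set V' | F V' /\ V `<=` V'].
    (* The tails of the chain form a filter, to which the covering characterization
       of compactness applies. *)
    have FF : Filter (filter_from F B).
      apply: filter_from_filter.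
        have [|V FV _] := cover (s + h); first by lra.
        by exists V.
      move=> V V' FV FV'; have [OO'|V'V] := Ft _ _ FV FV'.
        by exists V' => // U [FU V'U]; split; split => //; exact: subset_trans V'U.
      by exists V => // U [FU OU]; split; split => //; exact: subset_trans OU.
    have /compact_near_coveringP/(_ (set R) _ (fun V x => V x) FF) :=
      @segment_compact R (s + h) (t - h).
    case.
      move=> x; rewrite /= in_itv/= => /cover[V FV Vx].
      exists (V, B V) => /=.
        split; last by exists V.
        apply: open_nbhs_nbhs; split => //; rewrite -[V]setCK.
        by apply: closed_openC; have [] := FP V FV.
      by move=> [y U] /= [Oy [_ OU]]; exact: OU.
    by move=> V FV H; exists V => //; apply: H; split.
  have [cK _ gapK] := FP V FV.
  have nKO x : (~` \bigcup_(V in F) V) x -> (~` V) x.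
    by move=> Kx Vx; apply: Kx; exists V.
  have [|s' [s'h Ks' s'P]] := closed_last_point (t := s + h) cK.
    by exists s; [lra|exact: nKO].
  have [|t' [t'h Kt' t'P]] := closed_first_point (t := t - h) cK.
    by exists t; [lra|exact: nKO].
  have s's : s <= s' by apply: s'P; [lra|exact: nKO].
  have t't : t' <= t by apply: t'P; [lra|exact: nKO].
  have st' : s' < t' by lra.
  have gst : g s' = g t'.
    apply: gapK => // u su ut Ku.
    have [us|us] := leP u (s + h); first by have := s'P _ us Ku; lra.
    have [tu|tu] := leP (t - h) u; first by have := t'P _ tu Ku; lra.
    by apply: Ku; apply: Ocov; rewrite /= in_itv/=; lra.
  rewrite [e]splitr; apply: (@mdist_lt_le_trans _ _ _ (g s')).
    by apply: dsP; rewrite ler0_norm; lra.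
  by rewrite gst metric_sym; apply: dtP; rewrite ger0_norm; lra.
Qed.

(** In a minimal such set no loop is left to cut off: two remaining times with the
same value bound a gap. *)
Lemma minimal_agreement_set (g : R -> X) : continuous g ->
  exists K, agrees_across_gaps g K /\
    forall s t, 0 <= s -> s < t -> t <= 1 -> K s -> K t -> g s = g t ->
      forall u, s < u -> u < t -> ~ K u.
Proof.
move=> cg.
have [F FP Ft|V [PV maxV]] := @Zorn_bigcup R [set V | agrees_across_gaps g (~` V)].
  exact: agrees_across_gaps_chain.
exists (~` V); split => // s t s0 st t1 Ks Kt gst u su ut Ku.
have [cK outK gapK] := PV.
(* Otherwise the interval between [s] and [t] could be deleted as well. *)
pose V' := V `|` [set x | s < x < t].
apply: (maxV V').
  split; first by move=> x; left.
  by move=> /(_ u) H; apply: Ku; apply: H; right => /=; rewrite su.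
split.
- rewrite setCU; apply: closedI => //; apply: open_closedC.
  rewrite (_ : [set x | _] = [set` `]s, t[]); last first.
    by apply/seteqP; split=> x; rewrite /= in_itv.
  exact: interval_open.
- move=> x x01 [|/=]; first exact: outK.
  by move=> /andP[sx xt]; case: x01 => ?; lra.
- move=> p q pq Kp Kq gap.
  have Kp1 : (~` V) p by move=> ?; apply: Kp; left.
  have Kq1 : (~` V) q by move=> ?; apply: Kq; left.
  have sV : ~ V' s by case=> // /=; rewrite ltxx.
  have tV : ~ V' t by case=> // /=; rewrite ltxx andbF.
  have Ep x : (~` V') x -> x <= s \/ t <= x.
    move=> xV; have [|sx] := leP x s; first by left.
    have [|xt] := leP t x; first by right.
    by exfalso; apply: xV; right => /=; rewrite sx.
  have inV x : p < x -> x < q -> ~ (x <= s \/ t <= x) \/ V x.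
    move=> px xq; have [H|] := pselect (x <= s \/ t <= x); last by left.
    right; apply: contrapT => nV; apply: (gap x) => //= -[//|/= /andP[? ?]].
    by case: H => ?; lra.
  have [ps|tp] := Ep p Kp; have [qs|tq] := Ep q Kq.
  + by apply: gapK => // x px xq; have [|Vx] := inV x px xq; [case; left; lra|exact].
  + have -> : p = s.
      apply/eqP; rewrite eq_le ps /= leNgt; apply/negP => ps'.
      by apply: (gap s) => //; lra.
    have -> // : q = t.
    apply/eqP; rewrite eq_le tq andbT leNgt; apply/negP => tq'.
    by apply: (gap t) => //; lra.
  + exfalso; lra.
  + by apply: gapK => // x px xq; have [|Vx] := inV x px xq; [case; right; lra|exact].
Qed.

(** The path that waits, during each gap of a minimal set of times, at the point
where it entered the gap. *)
Lemma path_monotone (a b : X) (g : R -> X) : path_from_to a b g ->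
  exists h, [/\ path_from_to a b h, forall t, exists s, h t = g s &
    forall s u t, 0 <= s -> s <= u -> u <= t -> t <= 1 -> h s = h t -> h u = h s].
Proof.
move=> [cg ga gb]; have [K [[cK outK gapK] minK]] := minimal_agreement_set cg.
have /choice[k kP] : forall t, exists m,
    [/\ m <= t, K m & forall s, s <= t -> K s -> s <= m].
  move=> t; apply: closed_last_point => //.
  exists (Num.min 0 t); first by rewrite ge_min lexx orbT.
  by apply: outK; left; rewrite ge_min lexx.
have kt t : k t <= t by have [] := kP t.
have Kk t : K (k t) by have [] := kP t.
have kmax t s : s <= t -> K s -> s <= k t by have [_ _] := kP t; exact.
have kK t : K t -> k t = t.
  by move=> Kt; apply/eqP; rewrite eq_le kt /= kmax.
have kmono s t : s <= t -> k s <= k t.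
  by move=> st; apply: kmax => //; apply: le_trans (kt s) st.
exists (g \o k); split.
- split.
  + apply/continuous_realP => t e e0.
    have [Kt|nKt] := pselect (K t); last first.
      have [d /= d0 dP] : exists2 d : R, 0 < d & forall x, `|t - x| < d -> ~ K x.
        have /nbhs_ballP[d /= d0 dP] : nbhs t (~` K).
          by apply: open_nbhs_nbhs; split => //; exact: closed_openC.
        by exists d.
      exists d => // s ts /=; suff -> : k s = k t by rewrite mdistxx.
      have far x : K x -> d <= `|t - x|.
        by move=> Kx; rewrite leNgt; apply/negP => /dP.
      apply/eqP; rewrite eq_le; apply/andP; split; apply: kmax => //.
      * have [//|tk] := leP (k s) t; have := far _ (Kk s).
        by have := kt s => ?; move: ts; rewrite !ler0_norm; lra.
      * have [//|sk] := leP (k t) s; have := far _ (Kk t).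
        by have := kt t => ?; move: ts; rewrite !ger0_norm; lra.
    have /= [d d0 dP] := (continuous_realP g).1 cg t e e0; rewrite kK//.
    have right_close s : t <= s -> s < t + d -> mdist (g t) (g (k s)) < e.
      move=> ts sd; have tk := kmax _ _ ts Kt.
      by apply: dP; have := kt s => ?; rewrite ler0_norm; lra.
    have [[k' [Kk' dk' k't]]|nK] :=
        pselect (exists k', [/\ K k', t - d < k' & k' < t]).
      exists (Num.min d (t - k')); first by rewrite lt_min d0 subr_gt0.
      move=> s; rewrite lt_min => /andP[sd sk'].
      have [ts|st] := leP t s.
        by apply: right_close => //; move: sd; rewrite ler0_norm; lra.
      have k's : k' <= s by move: sk'; rewrite ger0_norm; lra.
      have := kmax _ _ k's Kk' => ?; have := kt s => ?.
      by apply: dP; rewrite ger0_norm; lra.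
    (* Here [t] is the right end of a gap. *)
    have gk' : g (k (t - d / 2)) = g t.
      have := kt (t - d / 2) => ?.
      apply: gapK => //; first by lra.
      move=> u ku ut Ku; have [ud|ud] := leP u (t - d / 2).
        by have := kmax _ _ ud Ku; lra.
      by apply: nK; exists u; split => //; lra.
    exists (d / 2); first by rewrite divr_gt0.
    move=> s sd; have [ts|st] := leP t s.
      by apply: right_close => //; move: sd; rewrite ler0_norm; lra.
    have sd2 : t - d / 2 < s by move: sd; rewrite ger0_norm; lra.
    suff -> : k s = k (t - d / 2) by rewrite gk' mdistxx.
    apply/eqP; rewrite eq_le; apply/andP; split; last by apply: kmono; lra.
    apply: kmax => //; rewrite leNgt; apply/negP => ks; apply: nK.
    by exists (k s); split => //; have := kt s => ?; lra.
  + by move=> t t0 /=; rewrite kK ?ga//; apply: outK; left.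
  + by move=> t t1 /=; rewrite kK ?gb//; apply: outK; right.
- by move=> t; exists (k t).
- move=> s u t s0 su ut t1 /= gst.
  have [ksu kut] := (kmono _ _ su, kmono _ _ ut).
  have [E|kst] := eqVneq (k s) (k t).
    by congr g; apply/eqP; rewrite eq_le ksu E kut.
  have {}kst : k s < k t by rewrite lt_neqAle kst (le_trans ksu).
  have [-> //|nus] := eqVneq (k u) (k s).
  have [->//|nut] := eqVneq (k u) (k t).
  have k0 : 0 <= k s by apply: kmax => //; apply: outK; left.
  exfalso; apply: (minK (k s) (k t) k0 kst _ (Kk s) (Kk t) gst (k u)) => //.
  + exact: le_trans t1.
  + by rewrite lt_neqAle eq_sym nus.
  + by rewrite lt_neqAle nut.
Qed.

End monotone_path.

(** * Injective reparametrization *)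

Section real_functions.
Context (R : realType).
Implicit Types u M F : R -> R.
Local Open Scope ring_scope.

Lemma continuous_real_realP u : continuous u <->
  forall t e, 0 < e -> exists2 d, 0 < d &
    forall s, `|t - s| < d -> `|u t - u s| < e.
Proof.
split=> [cf x e e0|H x].
  have /cvgrPdist_lt/(_ e e0)/nbhs_ballP[d /= d0 dP] := cf x.
  by exists d => // y; have := dP y.
by apply/cvgrPdist_lt => e /(H x)[d d0 dP]; apply/nbhs_ballP; exists d.
Qed.

Lemma running_sup u : continuous u -> (forall t, 0 <= u t <= 1) ->
  exists M, [/\ continuous M, forall t, 0 <= M t <= 1,
    forall s t, s <= t -> u s <= M t &
    forall t c, (forall s, s <= t -> u s <= c) -> M t <= c].
Proof.
move=> /continuous_real_realP cu u01.
pose A t := [set y | exists2 s, s <= t & u s = y].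
have A0 t : A t !=set0 by exists (u t); exists t.
have uA t : has_ubound (A t) by exists 1 => _ [s _ <-]; have /andP[] := u01 s.
pose M t := sup (A t).
have uM s t : s <= t -> u s <= M t.
  by move=> st; apply: (ub_le_sup (uA t)); exists s.
have Mu t c : (forall s, s <= t -> u s <= c) -> M t <= c.
  by move=> H; apply: ge_sup => // _ [s st <-]; exact: H.
exists M; split => //; last first.
  move=> t; apply/andP; split.
    by apply: le_trans (uM t t (lexx t)); have /andP[] := u01 t.
  by apply: Mu => s _; have /andP[] := u01 s.
apply/continuous_real_realP => t e e0.
have e20 : 0 < e / 2 / 2 by rewrite !divr_gt0.
have [d d0 dP] := cu t _ e20; exists d => // s ts.
(* On [p, q], short enough, the function [u] oscillates by at most [e / 2]. *)
have H p q : p <= q -> `|t - p| < d -> `|t - q| < d -> M p <= M q <= M p + e / 2.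
  move=> pq tp tq; apply/andP; split.
    by apply: Mu => x xp; apply: uM; exact: le_trans pq.
  apply: Mu => x xq; have [xp|px] := leP x p.
    by have := uM _ _ xp; lra.
  have tx : `|t - x| < d.
    by move: tp tq; rewrite !ltr_norml => /andP[? ?] /andP[? ?]; lra.
  have := dP _ tx; have := dP _ tp; have := uM _ _ (lexx p).
  by rewrite !ltr_norml => ? /andP[? ?] /andP[? ?]; lra.
have tt : `|t - t| < d by rewrite subrr normr0.
have [/H|/ltW/H] := leP t s; move=> /(_ _ _)/andP[] // ? ?;
  rewrite ltr_norml; lra.
Qed.

(** Countably many bounded monotone functions are merged into a single one that is
constant exactly where all of them are. *)
Lemma weighted_sum (M : nat -> R -> R) :
  (forall n, continuous (M n)) -> (forall n t, 0 <= M n t <= 1) ->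
  (forall n s t, s <= t -> M n s <= M n t) ->
  exists F, [/\ continuous F, forall s t, s <= t -> F s <= F t &
    forall s t, s <= t -> F s = F t <-> forall n, M n s = M n t].
Proof.
move=> cM M01 Mle.
pose P N t := \sum_(i < N) M i t / 2 ^+ i.+1.
have P_S N t : P N.+1 t = P N t + M N t / 2 ^+ N.+1.
  by rewrite /P big_ord_recr.
have pw n : 0 < 2 ^+ n :> R by rewrite exprn_gt0.
have term0 n t : 0 <= M n t / 2 ^+ n.+1.
  by rewrite divr_ge0 ?(ltW (pw _))//; have /andP[] := M01 n t.
have Pmono N j t : P N t <= P (N + j)%N t.
  by elim: j => [|j IH]; rewrite ?addn0// addnS P_S; have := term0 (N + j)%N t; lra.
have Ptail N j t : P (N + j)%N t <= P N t + (2 ^+ N)^-1 - (2 ^+ (N + j))^-1.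
  elim: j => [|j IH]; first by rewrite addn0; lra.
  rewrite addnS P_S.
  have : M (N + j)%N t / 2 ^+ (N + j).+1 <= (2 ^+ (N + j).+1)^-1.
    by rewrite ler_piMl ?invr_ge0 ?(ltW (pw _))//; have /andP[] := M01 (N + j)%N t.
  have E : (2 ^+ (N + j))^-1 = (2 ^+ (N + j).+1)^-1 *+ 2 :> R.
    by rewrite exprS invfM mulr2n; field; rewrite lt0r_neq0.
  by rewrite E mulr2n in IH; lra.
have Pub N N' t : P N' t <= P N t + (2 ^+ N)^-1.
  have [NN'|N'N] := leqP N N'.
    rewrite -(subnKC NN'); have := Ptail N (N' - N)%N t.
    by have := pw (N + (N' - N))%N; rewrite -invr_gt0; lra.
  have := Pmono N' (N - N')%N t; rewrite subnKC ?(ltnW N'N)//.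
  by have := pw N; rewrite -invr_gt0; lra.
pose A t := [set y | exists N, P N t = y].
have uA t : has_ubound (A t) by exists (P 0%N t + (2 ^+ 0)^-1) => _ [N <-].
pose F t := sup (A t).
have PF N t : P N t <= F t by apply: (ub_le_sup (uA t)); exists N.
have FP N t : F t <= P N t + (2 ^+ N)^-1.
  by apply: ge_sup => [|_ [N' <-]]; [exists (P 0%N t); exists 0%N|exact: Pub].
have Fge t c : (forall N, P N t <= c) -> F t <= c.
  by move=> H; apply: ge_sup => [|_ [N' <-]//]; exists (P 0%N t); exists 0%N.
have Ple N s t : s <= t -> P N s <= P N t.
  move=> st; apply: ler_sum => i _; rewrite ler_pM2r ?invr_gt0//.
  exact: Mle.
exists F; split.
- apply/continuous_real_realP => t e e0.
  have [N Ne] := geometric_small 1 (divr_gt0 e0 (ltr0n R 3)).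
  have cP : continuous (P N).
    rewrite /P; elim: (N) => [|n IH].
      have -> : (fun t => \sum_(i < 0) M i t / 2 ^+ i.+1) = (fun=> 0).
        by apply/funext => x; rewrite big_ord0.
      exact: cst_continuous.
    have -> : (fun t => \sum_(i < n.+1) M i t / 2 ^+ i.+1) =
        (fun t => \sum_(i < n) M i t / 2 ^+ i.+1) + (M n \* (fun=> (2 ^+ n.+1)^-1)).
      by apply/funext => x; rewrite big_ord_recr.
    move=> x; apply: continuousD; first exact: IH.
    by apply: continuousM; [exact: cM|exact: cst_continuous].
  have e30 : 0 < e / 3 by rewrite divr_gt0.
  have [d d0 dP] := (continuous_real_realP _).1 cP t _ e30.
  exists d => // s /dP; rewrite !ltr_norml.
  have := PF N t; have := PF N s; have := FP N t; have := FP N s.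
  by move: Ne; rewrite div1r; lra.
- by move=> s t st; apply: Fge => N; apply: le_trans (PF N t); exact: Ple.
- move=> s t st; split=> [FE n|ME]; last first.
    by congr (sup _); apply/seteqP; split=> _ [N <-]; exists N;
      apply: eq_bigr => i _; rewrite ME.
  apply/eqP; rewrite eq_le Mle//= leNgt; apply/negP => Mst.
  pose c := (M n t - M n s) / 2 ^+ n.+1.
  have c0 : 0 < c by rewrite divr_gt0// subr_gt0.
  suff : F s <= F t - c by rewrite FE; lra.
  have Pn j : P (n.+1 + j)%N s + c <= P (n.+1 + j)%N t.
    elim: j => [|j IH].
      rewrite addn0 !P_S /c mulrBl; have := Ple n _ _ st; lra.
    rewrite addnS 2!(P_S (n.+1 + j)%N).
    have : M (n.+1 + j)%N s / 2 ^+ (n.+1 + j).+1 <= M (n.+1 + j)%N t / 2 ^+ (n.+1 + j).+1.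
      by rewrite ler_pM2r ?invr_gt0//; exact: Mle.
    lra.
  apply: Fge => N; have := Pmono N n.+1 s; rewrite addnC => ?.
  by have := Pn N; have := PF (n.+1 + N)%N t; lra.
Qed.

Definition unit_clamp (t : R) : R := Num.min 1 (Num.max 0 t).

Lemma unit_clamp_itv t : 0 <= unit_clamp t <= 1.
Proof. by rewrite /unit_clamp le_min ge_min lexx ler01 /= le_max lexx. Qed.

Lemma unit_clamp_id t : 0 <= t <= 1 -> unit_clamp t = t.
Proof.
by move=> /andP[t0 t1]; rewrite /unit_clamp (max_idPr t0) (min_idPr t1).
Qed.

Lemma unit_clamp_le0 t : t <= 0 -> unit_clamp t = 0.
Proof. by move=> t0; rewrite /unit_clamp (max_idPl t0) (min_idPr ler01). Qed.

Lemma unit_clamp_ge1 t : 1 <= t -> unit_clamp t = 1.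
Proof. by move=> t1; apply/min_idPl; rewrite le_max t1 orbT. Qed.

Lemma continuous_unit_clamp : continuous unit_clamp.
Proof.
apply/continuous_real_realP => t e e0; exists e => // s.
rewrite !ltr_norml /unit_clamp /Num.min /Num.max.
by do ![case: ifPn; rewrite -?leNgt] => *; lra.
Qed.

End real_functions.

Section arcs.
Context (R : realType) (X : metricType R).
Local Open Scope ring_scope.

Definition arc_from_to (a b : X) (s : R -> X) :=
  path_from_to a b s /\
  forall t u, 0 <= t <= 1 -> 0 <= u <= 1 -> s t = s u -> t = u.

Lemma continuous_image_closed (g : R -> X) (p q : R) : continuous g ->
  closed (g @` `[p, q]).
Proof.
move=> cg; apply: compact_closed; first exact: metric_hausdorff.
apply: continuous_compact; last exact: segment_compact.
exact: continuous_subspaceT.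
Qed.

(** The parameter grows with the running suprema of bump functions, supported in
balls with rational radii around points of the path at rational times. If [h t]
differs from [h s] with [s <= t], monotonicity keeps [h t] away from the path up
to time [s], so some bump is positive at [t] and has been null until [s]. *)
Lemma monotone_path_parameter (a b : X) (h : R -> X) : path_from_to a b h ->
  (forall s u t, 0 <= s -> s <= u -> u <= t -> t <= 1 -> h s = h t -> h u = h s) ->
  exists F : R -> R, [/\ continuous F, forall s t, s <= t -> F s <= F t &
    forall s t, 0 <= s -> s <= t -> t <= 1 -> F s = F t <-> h s = h t].
Proof.
move=> [ch ha hb] hmono.
pose qr n : rat * rat := odflt (0, 0) (unpickle n).
pose u n t : R :=
  Num.min 1 (Num.max 0 (ratr (qr n).2 - mdist (h (ratr (qr n).1)) (h t))).
have cu n : continuous (u n).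
  apply/continuous_real_realP => t e e0.
  have [d d0 dP] := (continuous_realP h).1 ch t e e0.
  exists d => // s /dP; rewrite /u.
  set x := h (ratr _); set r : R := ratr _ => hts.
  have := metric_triangle x (h t) (h s); have := metric_triangle x (h s) (h t).
  rewrite (metric_sym (h s)) ltr_norml /Num.min /Num.max => ? ?.
  by do ![case: ifPn; rewrite -?leNgt] => *; lra.
have u01 n t : 0 <= u n t <= 1.
  by rewrite /u le_min ge_min lexx ler01 /= le_max lexx.
have /choice[M MP] : forall n, exists M : R -> R,
    [/\ continuous M, forall t, 0 <= M t <= 1,
    forall s t, s <= t -> u n s <= M t &
    forall t c, (forall s, s <= t -> u n s <= c) -> M t <= c].
  by move=> n; exact: running_sup.
have [cM M01] : (forall n, continuous (M n)) /\ forall n t, 0 <= M n t <= 1.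
  by split=> n; have [] := MP n.
have uM n s t : s <= t -> u n s <= M n t by have [_ _ + _] := MP n; apply.
have Mu n t c : (forall s, s <= t -> u n s <= c) -> M n t <= c.
  by have [_ _ _] := MP n; apply.
have Mle n s t : s <= t -> M n s <= M n t.
  by move=> st; apply: Mu => x xs; apply: uM; exact: le_trans st.
have [F [cF Fle FE]] := weighted_sum cM M01 Mle.
exists F; split => // s t s0 st t1; rewrite (FE _ _ st); split=> [ME|hst n].
  apply: contrapT => hst.
  have nht : ~ (h @` `[0, s]) (h t).
    move=> [x]; rewrite /= in_itv/= => /andP[x0 xs] hxt; apply: hst.
    by rewrite (hmono _ _ _ x0 xs st t1 hxt).
  have [e e0 eP] := closed_away (continuous_image_closed (p := 0) (q := s) ch) nht.
  have far x : x <= s -> e <= mdist (h t) (h x).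
    move=> xs; apply: eP; have [x0|x0] := leP x 0.
      by exists 0; rewrite /= ?in_itv/= ?lexx// !ha.
    by exists x; rewrite //= in_itv/= (ltW x0).
  have e4 : 0 < e / 4 by rewrite divr_gt0.
  have [d d0 dP] := (continuous_realP h).1 ch t _ e4.
  have [|q] := @rat_in_itvoo R (t - d) (t + d); first by lra.
  rewrite in_itv/= => /andP[q1 q2].
  have hq : mdist (h t) (h (ratr q)) < e / 4 by apply: dP; rewrite ltr_norml; lra.
  have [|r] := @rat_in_itvoo R (e / 4) (e / 2); first by lra.
  rewrite in_itv/= => /andP[r1 r2].
  pose n := pickle (q, r); have nE : qr n = (q, r) by rewrite /qr pickleK.
  have : M n s <= 0.
    apply: Mu => x xs; rewrite /u nE /= ge_min ge_max lexx /=; apply/orP; right.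
    have := far x xs; have := metric_triangle (h t) (h (ratr q)) (h x); lra.
  have := uM n t t (lexx t); rewrite /u nE /= -ME => H1 H2.
  have : 0 < Num.min 1 (Num.max 0 (ratr r - mdist (h (ratr q)) (h t))).
    by rewrite lt_min ltr01 /= lt_max; apply/orP; right; rewrite metric_sym; lra.
  lra.
apply/eqP; rewrite eq_le Mle//=; apply: Mu => x xt.
have [xs|sx] := leP x s; first exact: uM.
have -> : u n x = u n s by rewrite /u (hmono s x t)// ltW.
exact: uM.
Qed.

(** The path [h] and its parameter [F] have the same fibres, so [h] factors
through [F]. The factor is injective, and it is continuous because [F] maps
closed subsets of the unit interval to closed sets. *)
Lemma monotone_path_arc (a b : X) (h : R -> X) : a <> b -> path_from_to a b h ->
  (forall s u t, 0 <= s -> s <= u -> u <= t -> t <= 1 -> h s = h t -> h u = h s) ->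
  exists2 s, arc_from_to a b s & forall t, exists u, s t = h u.
Proof.
move=> ab hp hmono; have [ch ha hb] := hp.
have [F [cF Fle FE]] := monotone_path_parameter hp hmono.
have {}FE s t : 0 <= s <= 1 -> 0 <= t <= 1 -> F s = F t <-> h s = h t.
  move=> /andP[s0 s1] /andP[t0 t1]; have [st|/ltW ts] := leP s t; first exact: FE.
  by split=> /esym E; apply/esym/(FE t s).
have F01 : F 0 < F 1.
  rewrite lt_neqAle Fle// andbT; apply/eqP; rewrite FE ?lexx ?ler01//.
  by rewrite ha// hb.
pose clamp := @unit_clamp R.
pose phi u := F 0 + clamp u * (F 1 - F 0).
have phi_inj u v : phi u = phi v -> clamp u = clamp v.
  by move=> /addrI/mulIf; apply; rewrite subr_eq0 gt_eqF.
have cphi : continuous phi.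
  move=> u; apply: (@continuousD _ _ _ (fun=> F 0) (clamp \* fun=> F 1 - F 0)).
    exact: cst_continuous.
  by apply: continuousM; [exact: continuous_unit_clamp|exact: cst_continuous].
have /choice[tau tauP] : forall u, exists t, 0 <= t <= 1 /\ F t = phi u.
  move=> u; have [|||t] := @IVT R F 0 1 (phi u).
  - exact: ler01.
  - exact: continuous_subspaceT.
  - rewrite (min_idPl (ltW F01)) (max_idPr (ltW F01)) /phi.
    have /andP[c0 c1] := unit_clamp_itv u; apply/andP; split.
      by rewrite lerDl mulr_ge0// subr_ge0 ltW.
    by rewrite -lerBrDl ler_piMl// subr_ge0 ltW.
  - by rewrite in_itv/= => t01 Ft; exists t.
have tau01 u : 0 <= tau u <= 1 by have [] := tauP u.
have Ftau u : F (tau u) = phi u by have [] := tauP u.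
have htau u t : 0 <= t <= 1 -> F t = phi u -> h (tau u) = h t.
  by move=> t01 Ft; apply/FE => //; rewrite Ftau.
exists (h \o tau); last by move=> t; exists (tau t).
split; first split.
- apply/continuous_closedP => D cD.
  rewrite (_ : _ @^-1` D = phi @^-1` (F @` (`[0, 1] `&` h @^-1` D))); last first.
    apply/seteqP; split=> [u /= Du|u /= [t [+ Dt] Ft]].
      by exists (tau u) => //; split; rewrite //= in_itv/=.
    by rewrite in_itv/= => t01; rewrite (htau u t).
  apply: (@closed_comp _ _ phi) => [x _|]; first exact: cphi.
  apply: compact_closed; first exact: Rhausdorff.
  apply: continuous_compact; first exact: continuous_subspaceT.
  apply: compact_closedI; first exact: segment_compact.
  by apply: (@closed_comp _ _ h) => // x _; exact: ch.
- move=> u u0 /=; rewrite (htau u 0) ?ha ?lexx ?ler01//.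
  by rewrite /phi /clamp unit_clamp_le0// mul0r addr0.
- move=> u u1 /=; rewrite (htau u 1) ?hb ?lexx ?ler01//.
  by rewrite /phi /clamp unit_clamp_ge1// mul1r addrC subrK.
- move=> u v u01 v01 /= huv; rewrite -(unit_clamp_id u01) -(unit_clamp_id v01).
  by apply: phi_inj; rewrite -!Ftau; apply/FE.
Qed.

Lemma arc_near_connected (S : set X) (a b : X) (e : R) :
  compact [set: X] -> locally_connected X -> connected S -> S a -> S b ->
  a <> b -> 0 < e -> exists2 s : R -> X, arc_from_to a b s &
    forall t, exists2 z, S z & mdist z (s t) < e.
Proof.
move=> cX lc cS Sa Sb ab e0.
have [g gp gS] := path_near_connected cX lc cS Sa Sb e0.
have [h [hp hg hmono]] := path_monotone gp.
have [s sarc sh] := monotone_path_arc ab hp hmono.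
by exists s => // t; have [u ->] := sh t; have [v ->] := hg u; exact: gS.
Qed.

End arcs.

(** * Simple closed curves from pairs of arcs *)

Section circles.
Context (R : realType) (X : metricType R).
Local Open Scope ring_scope.

Lemma continuous_sqr_dist : continuous (fun p : R * R => p.1 ^+ 2 + p.2 ^+ 2).
Proof.
move=> p; apply: (@continuousD _ _ _ (fun p : R * R => p.1 ^+ 2) (fun p => p.2 ^+ 2)).
  by apply: (@continuous_comp _ _ _ (fst : R * R -> R) (fun y => y ^+ 2));
    [exact: cvg_fst|exact: exprn_continuous].
  by apply: (@continuous_comp _ _ _ (snd : R * R -> R) (fun y => y ^+ 2));
    [exact: cvg_snd|exact: exprn_continuous].
Qed.

Lemma unit_circle_closed : closed (@unit_circle R).
Proof.
apply: (@closed_comp _ _ (fun p : R * R => p.1 ^+ 2 + p.2 ^+ 2) [set x | x = 1]).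
  by move=> p _; exact: continuous_sqr_dist.
exact: closed_eq.
Qed.

Lemma unit_circle_bound (p : R * R) : unit_circle p ->
  -1 <= p.1 <= 1 /\ -1 <= p.2 <= 1.
Proof. by rewrite /unit_circle /= => pE; split; apply/andP; split; nra. Qed.

Lemma unit_circle_compact : compact (@unit_circle R).
Proof.
apply: (subclosed_compact unit_circle_closed
  (compact_setX (@segment_compact R (-1) 1) (@segment_compact R (-1) 1))).
by move=> p /unit_circle_bound[p1 p2]; split; rewrite /= in_itv.
Qed.

(** The upper half of the circle runs along one arc and the lower half along the
other, both by the abscissa. *)
Lemma arcs_simple_closed_curve (a b : X) (s t : R -> X) :
  arc_from_to a b s -> arc_from_to a b t ->
  (forall u v, 0 <= u <= 1 -> 0 <= v <= 1 -> s u = t v -> u = 0 \/ u = 1) ->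
  exists S : set X, simple_closed_curve S.
Proof.
move=> [[cs sa sb] s_inj] [[ct ta tb] t_inj] st.
pose x (p : R * R) := (1 + p.1) / 2.
pose k (p : R * R) := if 0 <= p.2 then s (x p) else t (x p).
have cmid : continuous (fun y : R => (1 + y) / 2).
  by apply/continuous_real_realP => u e e0; exists e => // v; rewrite !ltr_norml; lra.
have cx : continuous x.
  move=> p; apply: (@continuous_comp _ _ _ (fst : R * R -> R) (fun y => (1 + y) / 2)).
    exact: cvg_fst.
  exact: cmid.
pose C := @unit_circle R.
have x01 p : C p -> 0 <= x p <= 1.
  by move=> /unit_circle_bound[/andP[? ?] _]; rewrite /x; lra.
have s0 : s 0 = a by exact: sa.
have s1 : s 1 = b by exact: sb.
have t0 : t 0 = a by exact: ta.
have t1 : t 1 = b by exact: tb.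
(* The halves meet only at the points of abscissa [-1] and [1]. *)
have cross p q : C p -> C q -> s (x p) = t (x q) -> q.2 = 0.
  move=> Cp Cq E; have /x01 xp := Cp; have /x01 xq := Cq.
  have {E} [E|E] : x q = 0 \/ x q = 1.
    have [z|z] := st _ _ xp xq E; [left|right]; apply: t_inj => //;
      by rewrite ?lexx ?ler01// -E z ?s0 ?s1 ?t0 ?t1.
  - by move: Cq E; rewrite /C /unit_circle /x /=; nra.
  - by move: Cq E; rewrite /C /unit_circle /x /=; nra.
have k_inj p q : C p -> C q -> k p = k q -> p = q.
  move=> Cp Cq; have xp := x01 p Cp; have xq := x01 q Cq; rewrite /k.
  case: ifPn; case: ifPn; rewrite -?ltNge => q2 p2 E.
  - have {E} E := s_inj _ _ xp xq E.
    move: Cp Cq E p2 q2; case: p xp => p1 p2; case: q xq => q1 q2.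
    rewrite /C /unit_circle /x /= => _ _ Cp Cq E p20 q20.
    by congr pair; [lra|nra].
  - by exfalso; have := cross p q Cp Cq E; lra.
  - by exfalso; have := cross q p Cq Cp (esym E); lra.
  - have {E} E := t_inj _ _ xp xq E.
    move: Cp Cq E p2 q2; case: p xp => p1 p2; case: q xq => q1 q2.
    rewrite /C /unit_circle /x /= => _ _ Cp Cq E p20 q20.
    by congr pair; [lra|nra].
have ck : {within C, continuous k}.
  have -> : C = (C `&` [set p | 0 <= p.2]) `|` (C `&` [set p | p.2 <= 0]).
    apply/seteqP; split=> [p Cp|p [[]|[]]//].
    by have [p0|/ltW p0] := leP 0 p.2; [left|right].
  have c2 : continuous (snd : R * R -> R) by move=> p; exact: cvg_snd.
  apply: withinU_continuous.
  - apply: closedI; first exact: unit_circle_closed.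
    apply: (@closed_comp _ _ (snd : R * R -> R) [set y | 0 <= y]) => [p _|].
      exact: c2.
    exact: closed_ge.
  - apply: closedI; first exact: unit_circle_closed.
    apply: (@closed_comp _ _ (snd : R * R -> R) [set y | y <= 0]) => [p _|].
      exact: c2.
    exact: closed_le.
  - apply: (@subspace_eq_continuous _ _ _ (s \o x)).
      by move=> p; rewrite inE => -[_ /= p2]; rewrite /k /from_subspace p2.
    by apply: continuous_subspaceT => p; apply: continuous_comp; [exact: cx|exact: cs].
  - apply: (@subspace_eq_continuous _ _ _ (t \o x)).
      move=> p; rewrite inE => -[Cp /= p2]; rewrite /k /from_subspace; case: ifP => // p20.
      have : p.1 = -1 \/ p.1 = 1.
        have : (p.1 + 1) * (p.1 - 1) == 0.
          by apply/eqP; move: Cp; rewrite /C /unit_circle /=; nra.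
        by rewrite mulf_eq0 => /orP[]/eqP ?; [left|right]; lra.
      rewrite /x => -[] ->.
        by rewrite subrr mul0r t0 s0.
      by rewrite -[1 + 1]/(2%:R) divff// t1 s1.
    by apply: continuous_subspaceT => p; apply: continuous_comp; [exact: cx|exact: ct].
exists (k @` C).
have /choice[h hP] : forall y, exists p, (k @` C) y -> C p /\ k p = y.
  move=> y; have [[p Cp pE]|nS] := pselect ((k @` C) y); first by exists p.
  by exists (0, 0).
exists h, k; split.
- by move=> y /hP[].
- apply/continuous_closedP => D cD; apply/closed_subspaceP.
  exists (k @` (C `&` D)).
    apply: compact_closed; first exact: metric_hausdorff.
    apply: continuous_compact.
      by apply: continuous_subspaceW ck => p [].
    by apply: compact_closedI; first exact: unit_circle_compact.
  apply/seteqP; split=> [_ [[p [Cp Dp] <-] Sp]|y [/= Dh Sy]]; split=> //=.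
    have [Ch kh] := hP _ Sp.
    by move: Dp; rewrite -{1}(k_inj _ _ Ch Cp kh).
  by exists (h y) => //; [split => //|]; have [] := hP _ Sy.
- by move=> p Cp; exists p.
- exact: ck.
- split=> [y /hP[]//|p Cp].
  have [Ch kh] : C (h (k p)) /\ k (h (k p)) = k p by apply: hP; exists p.
  exact: k_inj.
Qed.

End circles.

(** * Arcs of a dendrite lie in every continuum through their endpoints *)

Section subarcs.
Context (R : realType) (X : metricType R).
Local Open Scope ring_scope.

Lemma convex_unit_itv (p q u : R) : 0 <= p <= 1 -> 0 <= q <= 1 ->
  0 <= u <= 1 -> 0 <= p + u * (q - p) <= 1.
Proof.
by move=> /andP[? ?] /andP[? ?] /andP[? ?]; apply/andP; split; nra.
Qed.

Lemma subarc (a b : X) (s : R -> X) (p q : R) : arc_from_to a b s ->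
  0 <= p <= 1 -> 0 <= q <= 1 -> p <> q ->
  arc_from_to (s p) (s q) (fun u => s (p + unit_clamp u * (q - p))).
Proof.
move=> [[cs sa sb] s_inj] p01 q01 pq.
have in01 u : 0 <= p + unit_clamp u * (q - p) <= 1.
  exact: convex_unit_itv (unit_clamp_itv u).
split; first split.
- move=> u; apply: (@continuous_comp _ _ _ (fun u => p + unit_clamp u * (q - p)) s).
    apply: (@continuousD _ _ _ (fun=> p) (@unit_clamp R \* fun=> q - p)).
      exact: cst_continuous.
    apply: continuousM; first exact: continuous_unit_clamp.
    exact: cst_continuous.
  exact: cs.
- by move=> u u0; rewrite unit_clamp_le0// mul0r addr0.
- by move=> u u1; rewrite unit_clamp_ge1// mul1r addrC subrK.
- move=> u v u01 v01 /s_inj => /(_ (in01 u) (in01 v)) /addrI/mulIf.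
  rewrite !unit_clamp_id//; apply; rewrite subr_eq0; apply/eqP => qp.
  exact: pq.
Qed.

Lemma connected_arc_image (a b : X) (s : R -> X) (p q : R) :
  path_from_to a b s -> connected (s @` `[p, q]).
Proof.
move=> [cs _ _]; apply: connected_continuous_connected.
  by apply/connected_intervalP; exact: interval_is_interval.
exact: continuous_subspaceT.
Qed.

(** If an arc left a continuum [C] through its endpoints, it could be closed up
inside a small neighbourhood of [C] by another arc that avoids the point left
behind; the piece between the last and the first meeting with that other arc
around this point completes a circle. *)
Lemma arc_sub_continuum (a b : X) (s : R -> X) (C : set X) : is_dendrite X ->
  arc_from_to a b s -> a <> b -> closed C -> connected C -> C a -> C b ->
  forall t, 0 <= t <= 1 -> C (s t).
Proof.
move=> hX sarc ab clC cC Ca Cb t0 t001; apply: contrapT => nCx.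
have [[cs sa sb] s_inj] := sarc.
have s0 : s 0 = a by exact: sa.
have s1 : s 1 = b by exact: sb.
have [e e0 eP] := closed_away clC nCx.
have [r rarc rC] := arc_near_connected (dendrite_compact hX)
  (dendrite_locally_connected hX) cC Ca Cb ab e0.
have [[cr ra rb] r_inj] := rarc.
have r0 : r 0 = a by exact: ra.
have r1 : r 1 = b by exact: rb.
pose B := r @` `[0, 1].
have clB : closed B by exact: continuous_image_closed.
have nBx : ~ B (s t0).
  move=> [u _ ru]; have [z Cz] := rC u; rewrite ru metric_sym.
  by have := eP z Cz; lra.
have Ba : B a by exists 0; rewrite //= in_itv/= lexx ler01.
have Bb : B b by exists 1; rewrite //= in_itv/= lexx ler01.
have clT : closed (s @^-1` B).
  by apply: (@closed_comp _ _ s) => // x _; exact: cs.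
move: (t001) => /andP[t00 t01].
have [|p [pt Bp pmax]] := closed_last_point (t := t0) clT.
  by exists 0; rewrite //= s0.
have [|q [tq Bq qmin]] := closed_first_point (t := t0) clT.
  by exists 1; rewrite //= s1.
have p0 : 0 <= p by apply: pmax; rewrite //= s0.
have q1 : q <= 1 by apply: qmin; rewrite //= s1.
have pt' : p < t0 by rewrite lt_neqAle pt andbT; apply/eqP => E; apply: nBx; rewrite -E.
have tq' : t0 < q by rewrite lt_neqAle tq andbT; apply/eqP => E; apply: nBx; rewrite E.
have [p' p'01 rp] := Bp; have [q' q'01 rq] := Bq.
rewrite /= in_itv/= in p'01 q'01.
have p01 : 0 <= p <= 1 by lra.
have q01 : 0 <= q <= 1 by lra.
have pq : p <> q by lra.
have pq' : p' <> q'.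
  move=> E; apply: pq; apply: s_inj => //.
  by rewrite /= in rp rq; rewrite -rp -rq E.
have sarc' := subarc sarc p01 q01 pq.
have rarc' := subarc rarc p'01 q'01 pq'.
rewrite rp rq /= in rarc'.
have [|S] := arcs_simple_closed_curve sarc' rarc'; last exact: dendrite_no_circle.
move=> u v u01 v01 E.
have Bw : B (s (p + u * (q - p))).
  rewrite -(unit_clamp_id u01) E; exists (p' + unit_clamp v * (q' - p')) => //.
  by rewrite /= in_itv/=; exact: convex_unit_itv (unit_clamp_itv v).
move: u01 => /andP[u0 u1].
have [le|lt] := leP (p + u * (q - p)) t0.
  by have := pmax _ le Bw => ?; left; nra.
by have := qmin _ (ltW lt) Bw => ?; right; nra.
Qed.

End subarcs.

(** * The betweenness relation of a dendrite *)

Section betweenness.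
Context (R : realType) (X : metricType R).
Local Open Scope ring_scope.

(** The least continuum containing [a] and [b]: in a dendrite, the arc joining
them. *)
Definition between (a b : X) : set X :=
  [set x | forall C, closed C -> connected C -> C a -> C b -> C x].

Lemma between_l (a b : X) : between a b a. Proof. by move=> C. Qed.

Lemma between_r (a b : X) : between a b b. Proof. by move=> C. Qed.

Lemma betweenC (a b x : X) : between a b x -> between b a x.
Proof. by move=> abx C clC cC Cb Ca; exact: abx. Qed.

Lemma betweenxx (a x : X) : between a a x -> x = a.
Proof.
move=> H; apply: (H [set a]) => //; last exact: connected1.
exact/accessible_closed_set1/hausdorff_accessible/metric_hausdorff.
Qed.

Lemma between_closed (a b : X) : closed (between a b).
Proof.
move=> x clx C clC cC Ca Cb; apply: (clC) => U /clx[y [aby Uy]].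
by exists y; split => //; exact: (aby C).
Qed.

Lemma between_trans (a b c x : X) : between a b c -> between a c x ->
  between a b x.
Proof.
move=> abc acx C clC cC Ca Cb.
exact: (acx C clC cC Ca (abc C clC cC Ca Cb)).
Qed.

Lemma between_split (a p b x : X) : between a b x ->
  between a p x \/ between p b x.
Proof.
move=> abx; apply: contrapT => /not_orP[nap npb].
move: nap => /existsNP[C] /not_implyP[clC] /not_implyP[cC]
  /not_implyP[Ca] /not_implyP[Cp nCx].
move: npb => /existsNP[D] /not_implyP[clD] /not_implyP[cD]
  /not_implyP[Dp] /not_implyP[Db nDx].
have : (C `|` D) x.
  apply: abx; [exact: closedU| |by left|by right].
  by apply: connectedU => //; exists p.
by case.
Qed.

Lemma uniform_continuum (e : R) : compact [set: X] ->
  locally_connected X -> 0 < e -> exists2 d, 0 < d &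
    forall x y : X, mdist x y < d -> exists C, [/\ closed C, connected C,
      C x, C y & forall z, C z -> mdist x z < e].
Proof.
move=> cX lc e0; have e20 : 0 < e / 2 by rewrite divr_gt0.
have [d d0 dP] := compact_uniform_connected cX lc e20.
exists d => // x y /dP[S [cS Sx Sy Se]]; exists (closure S); split.
- exact: closed_closure.
- exact: connected_closure.
- exact: subset_closure.
- exact: subset_closure.
- move=> z /(_ (ball z (e / 2)) (nbhsx_ballx _ _ e20))[w [Sw]].
  rewrite ballEmdist /= metric_sym => wz; rewrite [e]splitr.
  exact: mdist_lt_le_trans (Se w Sw) wz.
Qed.

Context (hX : is_dendrite X).

Let cX : compact [set: X] := dendrite_compact hX.
Let lcX : locally_connected X := dendrite_locally_connected hX.

(** A continuum through [a] and [b] that avoids [x] still avoids all points near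
[x] after the addition of a small continuum joining [b] to a nearby point. *)
Lemma not_between_near (a b x : X) : ~ between a b x ->
  exists2 e, 0 < e & forall b' x', mdist b b' < e -> mdist x x' < e ->
    ~ between a b' x'.
Proof.
move=> /existsNP[C] /not_implyP[clC] /not_implyP[cC]
  /not_implyP[Ca] /not_implyP[Cb nCx].
have [e e0 eP] := closed_away clC nCx.
have e20 : 0 < e / 2 by rewrite divr_gt0.
have [d d0 dP] := uniform_continuum cX lcX e20.
exists (Num.min d (e / 2)); first by rewrite lt_min d0.
move=> b' x'; rewrite !lt_min => /andP[/dP[D [clD cD Db Db' De]] _] /andP[_ xx'] H.
have : (C `|` D) x'.
  apply: H; [exact: closedU| |by left|by right].
  by apply: connectedU => //; exists b.
case=> [/eP|/De bx']; first by lra.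
have := eP b Cb; have := metric_triangle x x' b; rewrite (metric_sym x' b); lra.
Qed.

Lemma between_near (a b x : X) : between a b x -> x <> b ->
  exists2 e, 0 < e & forall b', mdist b b' < e -> between a b' x.
Proof.
move=> abx xb; have r0 : 0 < mdist b x by rewrite mdist_gt0; apply/eqP => /esym.
have [d d0 dP] := uniform_continuum cX lcX r0.
exists d => // b' /dP[D [clD cD Db Db' De]].
have [//|b'bx] := between_split b' abx.
by have := De _ (b'bx _ clD cD Db' Db); rewrite ltxx.
Qed.

Lemma dendrite_arc (a b : X) : a <> b -> exists2 s : R -> X, arc_from_to a b s &
  between a b = s @` `[0, 1].
Proof.
move=> ab.
have [s sarc _] := arc_near_connected cX lcX
  (continuum_connected (dendrite_continuum hX)) (I : setT a) (I : setT b) ab ltr01.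
exists s => //; have [[cs sa sb] _] := sarc.
apply/seteqP; split=> [x|_ [t t01 <-]].
  apply.
  - exact: continuous_image_closed.
  - exact: connected_arc_image sarc.1.
  - by exists 0; rewrite ?sa//= in_itv/= lexx ler01.
  - by exists 1; rewrite ?sb//= in_itv/= lexx ler01.
move=> C clC cC Ca Cb; apply: arc_sub_continuum sarc _ _ _ _ _ _ _ => //.
Qed.

Lemma between_connected (a b : X) : connected (between a b).
Proof.
have [->|/eqP ab] := eqVneq a b.
  rewrite (_ : between b b = [set b]); first exact: connected1.
  by apply/seteqP; split=> x; [exact: betweenxx|move=> ->; exact: between_l].
by have [s [sp _] ->] := dendrite_arc ab; exact: connected_arc_image sp.
Qed.

(** If [a] is an interior point of the arc from [p] to [b], the initial piece of
this arc up to [a] is a continuum that misses [b]. *)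
Lemma between_antisym (p a b : X) : between p b a -> between p a b -> a = b.
Proof.
move=> pba pab; have [E|/eqP pb] := eqVneq p b.
  by move: pba; rewrite E; exact: betweenxx.
have [s [sp s_inj] E] := dendrite_arc pb; have [cs sa sb] := sp.
move: (pba); rewrite E => -[t]; rewrite /= in_itv/= => t01 sta.
have [u /=] : (s @` `[0, t]) b.
  apply: pab; [exact: continuous_image_closed|exact: connected_arc_image sp| |].
    by exists 0; rewrite ?sa//= in_itv/= lexx; case/andP: t01.
  by exists t; rewrite //= in_itv/= lexx andbT; case/andP: t01.
rewrite in_itv/= => /andP[u0 ut] sub.
have /andP[t0 t1] := t01.
have u1 : u = 1.
  by apply: s_inj; [lra|rewrite lexx ler01|rewrite (sb 1)].
have -> : b = s t by rewrite -sub; congr s; case/andP: t01 => ? ?; lra.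
exact/esym.
Qed.

Lemma between_after (p v w x : X) : between p v x -> between x v w ->
  between p w x.
Proof.
move=> pvx xvw; have [//|wvx] := between_split w pvx.
have -> : x = w by apply: (@between_antisym v); exact: betweenC.
exact: between_r.
Qed.

Lemma between_close_l (a b : X) (e : R) : a <> b -> 0 < e ->
  exists y, [/\ between a b y, y <> a, y <> b & mdist a y < e].
Proof.
move=> ab e0; have [s [[cs sa sb] s_inj] ->] := dendrite_arc ab.
have s0 : s 0 = a by exact: sa.
have s1 : s 1 = b by exact: sb.
have [d d0 dP] := (continuous_realP s).1 cs 0 e e0.
pose t := Num.min (d / 2) (1 / 2).
have td : t <= d / 2 by rewrite ge_min lexx.
have t1 : t <= 1 / 2 by rewrite ge_min lexx orbT.
have t0 : 0 < t by rewrite lt_min !divr_gt0.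
have t01 : 0 <= t <= 1 by lra.
exists (s t); split.
- by exists t; rewrite //= in_itv/=.
- by rewrite -s0 => /s_inj; rewrite lexx ler01 => /(_ t01 isT); lra.
- by rewrite -s1 => /s_inj; rewrite lexx ler01 => /(_ t01 isT); lra.
- by rewrite -s0; apply: dP; rewrite sub0r normrN gtr0_norm//; lra.
Qed.

(** A maximal point [z], in the order of distance along arcs from a base point
[x0], among those that [f] moves away from [x0] must be fixed: otherwise the
points just beyond [z], towards [f z], would be moved away as well. *)
Lemma dendrite_fixed_point (f : X -> X) : continuous f -> exists p, f p = p.
Proof.
move=> cf; have [x0 _] := continuum_nonempty (dendrite_continuum hX).
pose E := [set x | between x0 (f x) x].
have clE : closed E.
  apply/closed_mdistP => x clx; apply: contrapT => /not_between_near[e e0 eP].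
  have [d d0 dP] := (continuous_mdistP f).1 cf x e e0.
  have [|y Ey xy] := clx (Num.min d e); first by rewrite lt_min d0.
  by move: xy; rewrite lt_min => /andP[/dP fxy xy]; exact: (eP _ _ fxy xy).
pose le (y z : {x | E x}) := `[< between x0 (sval z) (sval y) >].
have [| | | |[z Ez] zmax] := @Zorn {x | E x} le.
- by move=> y; apply/asboolP; exact: between_r.
- move=> y z w /asboolP yz /asboolP zw; apply/asboolP.
  exact: between_trans zw yz.
- move=> [y Ey] [z Ez] /asboolP/= yz /asboolP/= zy; have yzE := between_antisym yz zy.
  by subst z; congr exist; exact: Prop_irrelevance.
- move=> A Atot; have [[a0 Aa0]|A0] := pselect (A !=set0); last first.
    by exists (exist E x0 (between_l (a := x0) (b := f x0))) => y Ay; case: A0; exists y.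
  pose U (a : {x | E x}) : set X := [set y | E y /\ between x0 y (sval a)].
  have FF : ProperFilter (filter_from A U).
    apply: filter_from_proper => [|a Aa]; last first.
      by exists (sval a); split; [exact: (svalP a)|exact: between_r].
    apply: filter_from_filter; first by exists a0.
    move=> a b Aa Ab; have [/asboolP ab|/asboolP ba] := Atot _ _ Aa Ab.
      by exists b => // y [Ey by_]; split; split => //; exact: between_trans ab.
    by exists a => // y [Ey ay]; split; split => //; exact: between_trans ba.
  have [|y [_ yU]] := cX FF; first exact: filterT.
  have Ey : E y.
    apply: clE => B yB; have [|w [[Ew _] Bw]] := yU (U a0) B _ yB.
      by exists a0.
    by exists w.
  exists (exist _ y Ey) => a Aa; apply/asboolP; apply: contrapT.
  move=> /not_between_near[e e0 eP].
  have [||w [[_ aw]]] := yU (U a) (ball y e).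
  - by exists a.
  - exact: nbhsx_ballx.
  - rewrite ballEmdist => yw; apply: (eP _ _ yw _ aw).
    by rewrite mdistxx.
exists z; apply: contrapT => fz.
have zfz : z <> f z by move=> H; apply: fz.
(* A point close to [z] cannot separate two points close to [f z]. *)
have [e e0 eP] : exists2 e, 0 < e & forall y, mdist z y < e ->
    forall w, mdist (f z) w < e -> ~ between (f z) w y.
  have r0 : 0 < mdist (f z) z by rewrite mdist_gt0; apply/eqP.
  have r20 : 0 < mdist (f z) z / 2 by rewrite divr_gt0.
  have [d d0 dP] := uniform_continuum cX lcX r20.
  exists (Num.min d (mdist (f z) z / 2)); first by rewrite lt_min d0.
  move=> y; rewrite lt_min => /andP[_ zy] w.
  rewrite lt_min => /andP[/dP[D [clD cD Dz Dw De]] _] /(_ D clD cD Dz Dw)/De.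
  by have := metric_triangle (f z) y z; rewrite (metric_sym y z); lra.
have [d d0 dP] := (continuous_mdistP f).1 cf z e e0.
have [|y [zfy yz yfz zy]] := between_close_l (e := Num.min d e) zfz.
  by rewrite lt_min d0.
move: zy; rewrite lt_min => /andP[/dP fzy zy].
have x0fy : between x0 (f z) y.
  by move=> C clC cC Cx Cf; apply: (zfy C) => //; exact: (Ez C).
have Ey : E y.
  have [//|fyy] := between_split (f y) x0fy.
  by exfalso; apply: (eP y zy (f y) fzy); exact: betweenC.
have := zmax (exist _ y Ey) => H.
have /H/(congr1 sval)/= : le (exist _ z Ez) (exist _ y Ey).
  by apply/asboolP; exact: between_after Ez zfy.
exact: yz.
Qed.

End betweenness.

(** * Limit sets of orbits *)

Section limit_sets.
Context (R : realType) (X : metricType R).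
Implicit Types (f : X -> X) (x y z : X).
Local Open Scope ring_scope.

Lemma compact_cluster_seq2 (u v : nat -> X) : compact [set: X] ->
  exists a b, forall e N, 0 < e ->
    exists n, [/\ (N <= n)%N, mdist a (u n) < e & mdist b (v n) < e].
Proof.
move=> cX; pose F := (fun n => (u n, v n)) @ \oo.
have [|[a b] [_ ab]] := compact_setX cX cX (_ : ProperFilter F).
  by exists 0%N.
exists a, b => e N e0.
have [||[y z] [[n Nn [<- <-]]]] :=
    ab ((fun n => (u n, v n)) @` [set n | (N <= n)%N]) (ball a e `*` ball b e).
- by exists N => // n /= Nn; exists n.
- by exists (ball a e, ball b e) => //; split; exact: nbhsx_ballx.
- by rewrite !ballEmdist => -[/= ? ?]; exists n.
Qed.

Lemma iter_continuous f n : continuous f -> continuous (iter n f).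
Proof.
move=> cf; elim: n => [x|n IH x]; first exact: cvg_id.
by apply: (@continuous_comp _ _ _ (iter n f) f); [exact: IH|exact: cf].
Qed.

Lemma iter_mul f k n x : iter n (iter k f) x = iter (n * k) f x.
Proof. by elim: n => //= n ->; rewrite mulSn iterD. Qed.

Lemma iter_fixed f k n x : iter k f x = x -> iter (n * k) f x = x.
Proof. by move=> fx; rewrite -iter_mul; elim: n => //= n ->. Qed.

Lemma omega_limitP f x y : omega_limit f x y <->
  forall e N, 0 < e -> exists2 n, (N <= n)%N & mdist y (iter n f x) < e.
Proof.
rewrite omega_limitE; split=> [xy e N e0|H A B [N _ NA] /nbhs_mdistP[e e0 eB]].
  have [||z [[n Nn <-]]] := xy ((fun n => iter n f x) @` [set n | (N <= n)%N]) (ball y e).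
  - by exists N => // n /= Nn; exists n.
  - exact: nbhsx_ballx.
  - by rewrite ballEmdist; exists n.
have [n Nn ne] := H e N e0; exists (iter n f x); split; last exact: eB.
exact: (NA n).
Qed.

Lemma pos_increasing_ge (n : nat -> nat) i : pos_increasing n -> (i <= n i)%N.
Proof.
move=> [/increasing_seqP n_incr _]; elim: i => // i IH.
exact: leq_ltn_trans IH (n_incr i).
Qed.

(** The sequences are recovered from approximations at the scales [1 / (i + 1)] by
choosing each time after the previous one. *)
Lemma Omega_limitP f x y : Omega_limit f x y <->
  forall e N, 0 < e -> exists z n, [/\ (N <= n)%N, mdist x z < e &
    mdist y (iter n f z) < e].
Proof.
split=> [[u [n [/cvg_mdistP ux n_incr /cvg_mdistP ny]]] e N e0|H].
  have [N1 N1P] := ux e e0; have [N2 N2P] := ny e e0.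
  pose i := maxn N (maxn N1 N2); exists (u i), (n i); split.
  - by apply: leq_trans (pos_increasing_ge i n_incr); exact: leq_maxl.
  - by apply: N1P; rewrite /i !leq_max leqnn orbT.
  - by apply: N2P; rewrite /i !leq_max leqnn !orbT.
have /choice[g gP] : forall p : nat * nat, exists q : X * nat,
    [/\ (p.2 < q.2)%N, mdist x q.1 < p.1.+1%:R^-1 &
      mdist y (iter q.2 f q.1) < p.1.+1%:R^-1].
  move=> [i m]; have [|z [n [mn xz yz]]] := H i.+1%:R^-1 m.+1.
    by rewrite invr_gt0.
  by exists (z, n).
pose s := fix s i := if i is j.+1 then g (i, (s j).2) else g (0, 0)%N.
have sP i : mdist x (s i).1 < i.+1%:R^-1 /\
    mdist y (iter (s i).2 f (s i).1) < i.+1%:R^-1.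
  by case: i => [|i]; [have [] := gP (0, 0)%N|have [] := gP (i.+1, (s i).2)].
have s_incr i : ((s i).2 < (s i.+1).2)%N by have [] := gP (i.+1, (s i).2).
have small (h : nat -> X) a : (forall i, mdist a (h i) < i.+1%:R^-1) -> h @ \oo --> a.
  move=> ha; apply/cvg_mdistP => e e0.
  have [N _ NP] := near_infty_natSinv_lt (PosNum e0).
  by exists N => n Nn; apply: lt_trans (ha n) _; exact: (NP n).
exists (fst \o s), (snd \o s); split.
- by apply: small => i; have [] := sP i.
- split; first exact/increasing_seqP.
  case=> [|i] /=; first by have [] := gP (0, 0)%N.
  exact: leq_ltn_trans (s_incr i).
- by apply: small => i; have [] := sP i.
Qed.

Lemma omega_sub_Omega f x : omega_limit f x `<=` Omega_limit f x.
Proof.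
move=> y /omega_limitP xy; apply/Omega_limitP => e N e0.
by have [n Nn yn] := xy e N e0; exists x, n; rewrite mdistxx.
Qed.

Lemma omega_limit_iter f m x : omega_limit f (iter m f x) = omega_limit f x.
Proof.
apply/seteqP; split=> y /omega_limitP xy; apply/omega_limitP => e N e0.
  have [n Nn yn] := xy e N e0; exists (n + m)%N; first by lia.
  by rewrite iterD.
have [n Nn yn] := xy e (N + m)%N e0; exists (n - m)%N; first by rewrite leq_subRL; lia.
by rewrite -iterD subnK//; lia.
Qed.

Lemma omega_limit_invariant f n x y : continuous f ->
  omega_limit f x y -> omega_limit f x (iter n f y).
Proof.
move=> cf /omega_limitP xy; apply/omega_limitP => e N e0.
have [d d0 dP] := (continuous_mdistP _).1 (iter_continuous (n := n) cf) y e e0.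
have [m Nm ym] := xy d N d0; exists (n + m)%N; first by lia.
by rewrite iterD; exact: dP.
Qed.

Lemma omega_limit_trans f x y z : continuous f ->
  omega_limit f x y -> omega_limit f y z -> omega_limit f x z.
Proof.
move=> cf xy /omega_limitP yz; apply: (@omega_limit_closed _ _ f x).
move=> U /nbhs_mdistP[e e0 eU]; have [n _ zn] := yz e 0%N e0.
by exists (iter n f y); split; [exact: omega_limit_invariant|exact: eU].
Qed.

Lemma Omega_limit_closed_graph f x y :
  (forall e, 0 < e -> exists x' y',
    [/\ mdist x x' < e, mdist y y' < e & Omega_limit f x' y']) ->
  Omega_limit f x y.
Proof.
move=> H; apply/Omega_limitP => e N e0; have e20 : 0 < e / 2 by rewrite divr_gt0.
have [x' [y' [xx' yy' /Omega_limitP/(_ _ N e20)[z [n [Nn xz yz]]]]]] := H _ e20.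
exists z, n; rewrite [e]splitr; split => //.
  exact: mdist_lt_le_trans xz.
exact: mdist_lt_le_trans yz.
Qed.

(** All points of the orbit of [x] are fixed by [iter k f], hence so are their
limits. *)
Lemma omega_limit_fixed f k x y : continuous f -> iter k f x = x ->
  omega_limit f x y -> iter k f y = y.
Proof.
move=> cf fx /omega_limitP xy; apply: mdist_eq0P => e e0.
have e20 : 0 < e / 2 by rewrite divr_gt0.
have [d d0 dP] := (continuous_mdistP _).1 (iter_continuous (n := k) cf) y _ e20.
have [|n _ yn] := xy (Num.min d (e / 2)) 0%N; first by rewrite lt_min d0.
move: yn; rewrite lt_min => /andP[/dP fyn yn].
have fn : iter k f (iter n f x) = iter n f x by rewrite -iterD addnC iterD fx.
rewrite fn in fyn; rewrite [e]splitr; apply: mdist_lt_le_trans fyn _.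
by rewrite metric_sym.
Qed.

Lemma periodic_omega_limit f k x : (0 < k)%N -> iter k f x = x -> omega_limit f x x.
Proof.
move=> k0 fx; apply/omega_limitP => e N e0; exists (N * k)%N.
  by rewrite leq_pmulr.
by rewrite iter_fixed// mdistxx.
Qed.

Lemma range_iter_closed f n : compact [set: X] -> continuous f ->
  closed (range (iter n f)).
Proof.
move=> cX cf; apply: compact_closed; first exact: metric_hausdorff.
by apply: continuous_compact cX; exact/continuous_subspaceT/iter_continuous.
Qed.

End limit_sets.

(** * Maps of dendrites *)

Section dynamics.
Context (R : realType) (X : metricType R) (hX : is_dendrite X).
Context (f : X -> X) (cf : continuous f).
Implicit Types (x y z : X).
Local Open Scope ring_scope.

Let cX : compact [set: X] := dendrite_compact hX.
Let lcX : locally_connected X := dendrite_locally_connected hX.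

Let Y : set X := \bigcap_(n in [set n : nat | (0 < n)%N]) range (iter n f).

(** The image of an arc is a continuum, so it contains all that lies between the
images of the endpoints. *)
Lemma iter_image_between n a b x : between (iter n f a) (iter n f b) x ->
  exists2 w, between a b w & iter n f w = x.
Proof.
move=> H; suff [w aw wx] : (iter n f @` between a b) x by exists w.
have cfn := iter_continuous (n := n) cf.
apply: H.
- apply: compact_closed; first exact: metric_hausdorff.
  apply: continuous_compact; first exact: continuous_subspaceT.
  by apply: subclosed_compact cX _ => //; exact: between_closed.
- apply: connected_continuous_connected; first exact: between_connected.
  exact: continuous_subspaceT.
- by exists a => //; exact: between_l.
- by exists b => //; exact: between_r.
Qed.

Lemma between_core a b w : Y a -> Y b -> between a b w -> Y w.
Proof.
move=> Ya Yb abw n n0; apply: abw.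
- exact: range_iter_closed.
- apply: connected_continuous_connected; last exact/continuous_subspaceT/iter_continuous.
  exact: continuum_connected (dendrite_continuum hX).
- exact: Ya.
- exact: Yb.
Qed.

Lemma periodic_core : periodic_points f `<=` Y.
Proof.
move=> x [k k0 fx] n n0; exists (iter (n * k - n) f x) => //.
by rewrite -iterD subnKC ?leq_pmulr// iter_fixed.
Qed.

Lemma Omega_limit_core x : Omega_limit f x `<=` Y.
Proof.
move=> y /Omega_limitP xy n n0; apply: (@range_iter_closed _ _ f n cX cf).
move=> U /nbhs_mdistP[e e0 eU]; have [z [m [nm xz ym]]] := xy e n e0.
exists (iter m f z); split; last exact: eU.
by exists (iter (m - n) f z) => //; rewrite -iterD subnKC.
Qed.

Section omega_eq_Omega.
Context (oO : forall x, omega_limit f x = Omega_limit f x).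

(** Limit sets are minimal: a limit point [w] of the orbit of [z] is one of the
orbit of each [iter n f z], hence also of the orbit of their limit [y], since the
limit relation is closed. *)
Lemma omega_limit_minimal z y : omega_limit f z y ->
  omega_limit f y = omega_limit f z.
Proof.
move=> zy; apply/seteqP; split=> w; first exact: omega_limit_trans.
move=> zw; rewrite oO; apply: Omega_limit_closed_graph => e e0.
have [n _ yn] := (omega_limitP f z y).1 zy e 0%N e0.
by exists (iter n f z), w; rewrite mdistxx -oO omega_limit_iter.
Qed.

(** A limit [z] of [n]-th preimages of [y], for increasing [n], has [y] in
[Omega_limit f z], which is a minimal set. *)
Lemma core_recurrent y : Y y -> omega_limit f y y.
Proof.
move=> Yy; have /choice[u uP] : forall n, exists z, iter n.+1 f z = y.
  by move=> n; have [z _ zy] := Yy n.+1 isT; exists z.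
have [z zu] := compact_cluster_seq u cX.
have zy : omega_limit f z y.
  rewrite oO; apply/Omega_limitP => e N e0; have [n Nn zn] := zu e N e0.
  by exists (u n), n.+1; rewrite uP mdistxx; split => //; exact: leqW.
by rewrite (omega_limit_minimal zy).
Qed.

(** If [iter k f] moved [x] away from [p], then choosing preimages of [x] ever
closer to [p] along the arc would produce a backward orbit converging to a fixed
point [q] of [iter k f]. So [x] would lie in [Omega_limit f q], which is the
orbit of [q]. *)
Lemma not_moved_away p k x : f p = p -> between p (iter k f x) x ->
  iter k f x = x.
Proof.
have [->//|k0] := posnP k.
move=> fp fxx; pose g := iter k f.
have gp : g p = p by rewrite /g; elim: (k) => //= n ->.
have /choice[F FP] : forall y, exists y', between p (g y) y ->
    between p y y' /\ g y' = y.
  move=> y; have [H|nH] := pselect (between p (g y) y); last by exists y.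
  rewrite -{1}gp in H; have [w pyw gw] := iter_image_between H.
  by exists w.
pose u n := iter n F x.
have uP n : between p (g (u n)) (u n).
  elim: n => [//|n IH]; have [H1 H2] := FP _ IH.
  by rewrite /= H2.
have uS n : between p (u n) (u n.+1) by have [] := FP _ (uP n).
have gu n : g (u n.+1) = u n by have [] := FP _ (uP n).
have u_le n m : between p (u n) (u (n + m)%N).
  elim: m => [|m IH]; first by rewrite addn0; exact: between_r.
  by rewrite addnS; exact: between_trans IH (uS _).
(* The sequence [u] decreases along the arc from [p] to [x], so it has only one
   cluster point; [g] shifts [u], so it fixes this point. *)
pose limit q := forall e N, 0 < e -> exists2 n, (N <= n)%N & mdist q (u n) < e.
have limit_le q n : limit q -> between p (u n) q.
  move=> lq; apply: between_closed => U /nbhs_mdistP[e e0 eU].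
  have [m nm qm] := lq e n e0; exists (u m); split; last exact: eU.
  by rewrite -(subnKC nm).
have limit_le2 q q' : limit q -> limit q' -> between p q q'.
  move=> lq lq'; apply: contrapT => /(not_between_near hX)[e e0 eP].
  have [n _ qn] := lq e 0%N e0; apply: (eP _ q' qn); first by rewrite mdistxx.
  exact: limit_le.
have [q lq] := compact_cluster_seq u cX.
have lgq : limit (g q).
  move=> e N e0.
  have [d d0 dP] := (continuous_mdistP _).1 (iter_continuous (n := k) cf) q e e0.
  have [[//|n] Nn qn] := lq d N.+1 d0; exists n => //.
  by rewrite -gu; exact: dP.
have gq : iter k f q = q.
  by apply: (between_antisym hX (p := p)); exact: limit_le2.
apply: (omega_limit_fixed cf gq); rewrite oO; apply/Omega_limitP => e N e0.
have [n Nn qn] := lq e N e0.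
exists (u n), (n * k)%N; split => //; first by rewrite (leq_trans Nn)// leq_pmulr.
rewrite -iter_mul (_ : iter n (iter k f) (u n) = x) ?mdistxx//.
by elim: (n) => // m IH; rewrite iterSr -/g gu.
Qed.

(** If equicontinuity fails at [x], the images of small continua around [x] contain
pairs of points near two distinct points [a] and [b] of [Omega_limit f x], hence
any point [c] strictly between [a] and [b]. Then [a], [b] and [c] lie in one
minimal set, so the orbit of [c] comes close to both [a] and [b], and [c] is
moved away from a fixed point. *)
Lemma pointwise_equicontinuous x e : 0 < e -> exists2 d, 0 < d &
  forall y, mdist x y < d -> forall n, mdist (iter n f x) (iter n f y) < e.
Proof.
move=> e0; apply: contrapT => nequi.
(* Failures of equicontinuity at [x] occur at arbitrarily late times. *)
have finite_time N : exists2 d, 0 < d & forall y, mdist x y < d ->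
    forall n, (n < N)%N -> mdist (iter n f x) (iter n f y) < e.
  elim: N => [|N [d d0 dP]]; first by exists 1.
  have [d' d'0 d'P] := (continuous_mdistP _).1 (iter_continuous (n := N) cf) x e e0.
  exists (Num.min d d'); first by rewrite lt_min d0.
  move=> y; rewrite lt_min => /andP[xy xy'] n; rewrite ltnS leq_eqVlt.
  by case/orP => [/eqP ->|]; [exact: d'P|exact: dP].
have /choice[u uP] : forall N, exists q : X * nat, [/\ mdist x q.1 < N.+1%:R^-1,
    (N <= q.2)%N & e <= mdist (iter q.2 f x) (iter q.2 f q.1)].
  move=> N; have [d d0 dP] := finite_time N.
  apply: contrapT => nu; apply: nequi.
  exists (Num.min d N.+1%:R^-1); first by rewrite lt_min d0 /= invr_gt0.
  move=> y; rewrite lt_min => /andP[/dP xy xy'] n.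
  rewrite ltNge; apply/negP => en; apply: nu; exists (y, n); split => //=.
  by rewrite leqNgt; apply/negP => /xy; rewrite ltNge en.
have [a [b abP]] := compact_cluster_seq2
  (fun i => iter (u i).2 f x) (fun i => iter (u i).2 f (u i).1) cX.
have ab : a <> b.
  move=> ab; have [|n [_ an bn]] := abP (e / 2) 0%N; first by rewrite divr_gt0.
  have [_ _] := uP n; rewrite leNgt => /negP; apply.
  rewrite [e]splitr; apply: mdist_lt_le_trans (_ : mdist _ b < _) bn.
  by rewrite -ab metric_sym.
have near_x d N : 0 < d -> exists M, forall i, (M <= i)%N ->
    mdist x (u i).1 < d /\ (N <= (u i).2)%N.
  move=> d0; have [M _ MP] := near_infty_natSinv_lt (PosNum d0).
  exists (maxn M N) => i; rewrite geq_max => /andP[Mi Ni].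
  have [xu iu _] := uP i; split; last exact: leq_trans iu.
  exact: lt_trans xu (MP i Mi).
have xa : omega_limit f x a.
  apply/omega_limitP => d N d0; have [M MP] := near_x d N d0.
  have [n [Mn an _]] := abP d M d0; exists (u n).2 => //.
  by have [] := MP n Mn.
have xb : omega_limit f x b.
  rewrite oO; apply/Omega_limitP => d N d0; have [M MP] := near_x d N d0.
  have [n [Mn _ bn]] := abP d M d0; exists (u n).1, (u n).2.
  by have [] := MP n Mn.
have [c [abc ca cb _]] := between_close_l hX ab ltr01.
have [ea ea0 eaP] := between_near hX (betweenC abc) ca.
have xc : omega_limit f x c.
  rewrite oO; apply/Omega_limitP => d N d0.
  have [eb eb0 ebP] : exists2 eb, 0 < eb & forall a' b', mdist a a' < eb ->
      mdist b b' < eb -> between a' b' c.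
    have r0 : 0 < mdist a c by rewrite mdist_gt0; apply/eqP => /esym.
    have [eb eb0 ebP] := between_near hX abc cb.
    have [ec ec0 ecP] := uniform_continuum cX lcX r0.
    exists (Num.min eb ec); first by rewrite lt_min eb0.
    move=> a' b'; rewrite !lt_min => /andP[_ /ecP[D [clD cD Da Da' De]]] /andP[bb' _].
    have [aa'c|//] := between_split a' (ebP _ bb').
    by have := De c (aa'c D clD cD Da Da'); rewrite ltxx.
  have [dc dc0 dcP] := uniform_continuum cX lcX d0.
  have [M MP] := near_x dc N dc0.
  have [n [Mn an bn]] := abP eb M eb0.
  have [/dcP[D [clD cD Dx Du De]] Nn] := MP n Mn.
  have [w xuw wc] := iter_image_between (ebP _ _ an bn).
  exists w, (u n).2; split => //; last by rewrite wc mdistxx.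
  by apply: De; exact: xuw.
have [p fp] := dendrite_fixed_point hX cf.
have escape v : omega_limit f x v -> c <> v -> ~ between p v c.
  move=> xv cv pvc; have [d d0 dP] := between_near hX pvc cv.
  have r0 : 0 < mdist v c by rewrite mdist_gt0; apply/eqP => /esym.
  have := xv; rewrite -(omega_limit_minimal xc) => /omega_limitP cvP.
  have [|n _] := cvP (Num.min d (mdist v c)) 0%N; first by rewrite lt_min d0.
  rewrite lt_min => /andP[/dP /(not_moved_away fp) ->].
  by rewrite ltxx.
have [/betweenC|] := between_split p abc; exact: escape.
Qed.

Lemma omega_eq_Omega_equicontinuous : equicontinuous_map f.
Proof.
move=> e e0; apply: contrapT => nequi.
have /choice[u uP] : forall N, exists q : X * X, mdist q.1 q.2 < N.+1%:R^-1 /\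
    exists n, e <= mdist (iter n f q.1) (iter n f q.2).
  move=> N; apply: contrapT => nu; apply: nequi; exists N.+1%:R^-1.
    by rewrite invr_gt0.
  move=> y z yz n _; rewrite ltNge; apply/negP => en; apply: nu.
  by exists (y, z); split => //; exists n.
have [x xu] := compact_cluster_seq (fst \o u) cX.
have e20 : 0 < e / 2 by rewrite divr_gt0.
have [d d0 dP] := pointwise_equicontinuous x e20.
have d20 : 0 < d / 2 by rewrite divr_gt0.
have [N _ NP] := near_infty_natSinv_lt (PosNum d20).
have [i Ni /= xi] := xu (d / 2) N d20.
have [ui [n]] := uP i; rewrite leNgt => /negP; apply.
have {}ui := lt_trans ui (NP i Ni).
rewrite [e]splitr; apply: (@mdist_lt_le_trans _ _ _ (iter n f x)).
  by rewrite metric_sym; apply: dP; lra.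
by apply: dP; rewrite [d]splitr; exact: mdist_lt_le_trans ui.
Qed.

(** If [x] were not periodic, recurrence of [v] would provide a point [w] beyond
[x] mapped to [x], and recurrence of [w] would then move [x] away from [p]. *)
Lemma core_between_periodic p v x : f p = p -> Y v -> between p v x -> x <> v ->
  periodic_points f x.
Proof.
move=> fp Yv pvx xv; apply: contrapT => nper.
have not_away n : (0 < n)%N -> ~ between p (iter n f x) x.
  by move=> n0 /(not_moved_away fp) fx; apply: nper; exists n.
have Yp : Y p by apply: periodic_core; exists 1%N.
have [d d0 dP] := between_near hX pvx xv.
have [n n0 vn] := (omega_limitP _ _ _).1 (core_recurrent Yv) d 1%N d0.
have [//|] := between_split (iter n f x) (dP _ vn).
  exact: not_away.
move=> /iter_image_between[w xvw wx].
have pwx : between p w x := between_after hX pvx xvw.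
have pvw : between p v w.
  by move=> C clC cC Cp Cv; apply: (xvw C) => //; exact: (pvx C).
have xw : x <> w by move=> E; apply: nper; exists n; rewrite // {1}E.
have [e e0 eP] := between_near hX pwx xw.
have [m nm wm] := (omega_limitP _ _ _).1
  (core_recurrent (between_core Yp Yv pvw)) e n.+1 e0.
apply: (not_away (m - n)%N); first by rewrite subn_gt0.
have -> : iter (m - n) f x = iter m f w.
  by rewrite -[in RHS](subnK (ltnW nm)) iterD wx.
exact: eP.
Qed.

Lemma closure_periodic_core : closure (periodic_points f) = Y.
Proof.
apply/seteqP; split=> y.
  move=> yP n n0; apply: (@range_iter_closed _ _ f n cX cf).
  by apply: closure_subset yP => z /periodic_core; apply.
move=> Yy U /nbhs_mdistP[e e0 eU]; have [p fp] := dendrite_fixed_point hX cf.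
have [E|/eqP yp] := eqVneq y p.
  by exists p; split; [exists 1%N|apply: eU; rewrite E mdistxx].
have [z [pyz zy _ yz]] := between_close_l hX yp e0.
exists z; split; last exact: eU.
exact: (core_between_periodic fp Yy (betweenC pyz)).
Qed.

(** Limit sets are upper semicontinuous because the limit relation is closed. *)
Lemma omega_upper x e : 0 < e -> exists2 d, 0 < d & forall y, mdist x y < d ->
  forall b, omega_limit f y b -> exists2 a, omega_limit f x a & mdist a b < e.
Proof.
move=> e0; apply: contrapT => H.
have /choice[u uP] : forall N, exists q : X * X, [/\ mdist x q.1 < N.+1%:R^-1,
    omega_limit f q.1 q.2 & forall a, omega_limit f x a -> e <= mdist a q.2].
  move=> N; apply: contrapT => nu; apply: H; exists N.+1%:R^-1.
    by rewrite invr_gt0.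
  move=> y xy b yb; apply: contrapT => na; apply: nu; exists (y, b); split => //=.
  by move=> a xa; rewrite leNgt; apply/negP => ab; apply: na; exists a.
have [b bP] := compact_cluster_seq (snd \o u) cX.
have xb : omega_limit f x b.
  rewrite oO; apply: Omega_limit_closed_graph => d d0.
  have [N _ NP] := near_infty_natSinv_lt (PosNum d0).
  have [n Nn /= bn] := bP d N d0; exists (u n).1, (u n).2.
  have [xu uu _] := uP n; rewrite -oO; split => //.
  exact: lt_trans xu (NP n Nn).
have [n _ /= bn] := bP e 0%N e0; have [_ _ /(_ b xb)] := uP n.
by rewrite leNgt bn.
Qed.

(** A limit [b] of points of [omega_limit f y], as [y] tends to [x], belongs to
the minimal set [omega_limit f x]. So the orbit of [b] comes close to any point
of this set, and the orbits of nearby points of [omega_limit f y] follow. *)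
Lemma omega_lower x e : 0 < e -> exists2 d, 0 < d & forall y, mdist x y < d ->
  forall a, omega_limit f x a -> exists2 b, omega_limit f y b & mdist a b < e.
Proof.
move=> e0; apply: contrapT => H.
have /choice[u uP] : forall N, exists q : X * X, [/\ mdist x q.1 < N.+1%:R^-1,
    omega_limit f x q.2 & forall b, omega_limit f q.1 b -> e <= mdist q.2 b].
  move=> N; apply: contrapT => nu; apply: H; exists N.+1%:R^-1.
    by rewrite invr_gt0.
  move=> y xy a xa; apply: contrapT => nb; apply: nu; exists (y, a); split => //=.
  by move=> b yb; rewrite leNgt; apply/negP => ab; apply: nb; exists b.
have /choice[w wP] : forall N, exists b, omega_limit f (u N).1 b.
  by move=> N; have [b] := omega_limit_nonempty cX f (u N).1; exists b.
have [a [b abP]] := compact_cluster_seq2 (snd \o u) w cX.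
have xb : omega_limit f x b.
  rewrite oO; apply: Omega_limit_closed_graph => d d0.
  have [N _ NP] := near_infty_natSinv_lt (PosNum d0).
  have [n [Nn _ bn]] := abP d N d0; exists (u n).1, (w n).
  have [xu _ _] := uP n; rewrite -oO; split => //.
  exact: lt_trans xu (NP n Nn).
have xa : omega_limit f x a.
  apply: omega_limit_closed => U /nbhs_mdistP[d d0 dU].
  have [n [_ an _]] := abP d 0%N d0; exists (u n).2; split; last exact: dU.
  by have [] := uP n.
have e30 : 0 < e / 3 by rewrite divr_gt0.
have := xa; rewrite -(omega_limit_minimal xb) => /omega_limitP/(_ _ 0%N e30)[m _ abm].
have [d d0 dP] := (continuous_mdistP _).1 (iter_continuous (n := m) cf) b _ e30.
have [|n [_ an /= bn]] := abP (Num.min d (e / 3)) 0%N; first by rewrite lt_min d0.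
move: an bn; rewrite !lt_min => /andP[_ /= an] /andP[/dP bn _].
have [_ _ /(_ (iter m f (w n)))] := uP n.
rewrite leNgt => /(_ (omega_limit_invariant _ cf (wP n)))/negP; apply.
have -> : e = e / 3 + (e / 3 + e / 3) by field.
apply: mdist_lt_le_trans (_ : mdist _ a < _) _; first by rewrite metric_sym.
exact: mdist_lt_le_trans bn.
Qed.

Lemma omega_map_continuous : continuous (omega_map cX f).
Proof.
apply/continuous_mdistP => x e e0; have e20 : 0 < e / 2 by rewrite divr_gt0.
have [d d0 dP] := omega_upper x e20; have [d' d'0 d'P] := omega_lower x e20.
exists (Num.min d d'); first by rewrite lt_min d0.
move=> y; rewrite lt_min => /andP[/dP xy /d'P yx].
rewrite hyperspace_mdistE /=; apply: (@le_lt_trans _ _ (e / 2)); last by lra.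
apply: ge_inf; first exact: hausdorff_radii_lb.
split => // a.
  by move=> /yx[b yb ab]; exists b => //; rewrite ballEmdist /= metric_sym.
by move=> /xy[b xb ba]; exists b => //; rewrite ballEmdist.
Qed.

End omega_eq_Omega.

Lemma omega_map_close x y e : mdist (omega_map cX f x) (omega_map cX f y) < e ->
  forall a, omega_limit f x a -> exists2 b, omega_limit f y b & mdist a b < e.
Proof.
rewrite hyperspace_mdistE /= => xy a xa; rewrite -subr_gt0 in xy.
have [r [_ xyr _]] := hausdorff_radii_inf cX (omega_limit_nonempty cX f x)
  (omega_limit_nonempty cX f y) xy.
rewrite addrC subrK => re; have [b yb] := xyr a xa; rewrite ballEmdist /= => ba.
by exists b => //; rewrite metric_sym; exact: lt_trans re.
Qed.

(** A point [y] of [Omega_limit f x] is a limit of periodic points, hence lies in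
its own limit set by continuity. It is also a limit of points [iter n f z] with
[z] close to [x], whose limit sets are those of [z]; so the limit sets of [x] and
[y] are equal, again by continuity. *)
Lemma omega_map_continuous_omega_eq_Omega :
  continuous (omega_map cX f) -> closure (periodic_points f) = Y ->
  forall x, omega_limit f x = Omega_limit f x.
Proof.
move=> /continuous_mdistP co perY x; apply/seteqP; split; first exact: omega_sub_Omega.
move=> y xy; have := Omega_limit_core xy; rewrite -perY => y_per.
have yy : omega_limit f y y.
  apply: omega_limit_closed => U /nbhs_mdistP[e e0 eU].
  have e20 : 0 < e / 2 by rewrite divr_gt0.
  have [d d0 dP] := co y _ e20.
  have [|z [[k k0 fz]]] := y_per (ball y (Num.min d (e / 2))).
    by apply: nbhsx_ballx; rewrite lt_min d0.
  rewrite ballEmdist /= lt_min => /andP[/dP yz yz'].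
  rewrite metric_sym in yz.
  have [w yw zw] := omega_map_close yz (periodic_omega_limit k0 fz).
  exists w; split => //; apply: eU; rewrite [e]splitr.
  exact: mdist_lt_le_trans zw.
apply: omega_limit_closed => U /nbhs_mdistP[e e0 eU].
have e20 : 0 < e / 2 by rewrite divr_gt0.
have [dx dx0 dxP] := co x _ e20; have [dy dy0 dyP] := co y _ e20.
have [|z [n [_ xz yz]]] := (Omega_limitP f x y).1 xy (Num.min dx dy) 0%N.
  by rewrite lt_min dx0.
move: xz yz; rewrite !lt_min => /andP[/dxP xz _] /andP[_ /dyP yz].
have [w zw yw] := omega_map_close yz yy; rewrite omega_limit_iter in zw.
rewrite metric_sym in xz; have [v xv wv] := omega_map_close xz zw.
exists v; split => //; apply: eU; rewrite [e]splitr.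
exact: mdist_lt_le_trans wv.
Qed.

Lemma equicontinuous_omega_eq_Omega : equicontinuous_map f ->
  forall x, omega_limit f x = Omega_limit f x.
Proof.
move=> equi x; apply/seteqP; split; first exact: omega_sub_Omega.
move=> y /Omega_limitP xy; apply/omega_limitP => e N e0.
have e20 : 0 < e / 2 by rewrite divr_gt0.
have [d d0 dP] := equi _ e20.
have [|z [n [Nn xz yz]]] := xy (Num.min d (e / 2)) N.+1.
  by rewrite lt_min d0.
move: xz yz; rewrite !lt_min => /andP[/dP xz _] /andP[_ yz].
exists n; first exact: ltnW.
rewrite [e]splitr; apply: mdist_lt_le_trans yz _.
by rewrite metric_sym; apply: xz; exact: leq_trans Nn.
Qed.

End dynamics.

Unset Implicit Arguments.

Theorem theorem4p12 (R : realType) (X : metricType R) (hX : is_dendrite X)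
    (f : X -> X) (hf : continuous f) :
  [<-> continuous (omega_map (dendrite_compact hX) f) /\
       closure (periodic_points f) =
         \bigcap_(n in [set n : nat | (0 < n)%N]) range (iter n f);
       forall x : X, omega_limit f x = Omega_limit f x;
       equicontinuous_map f].
Proof.
split.
  move=> [co per]; exact: omega_map_continuous_omega_eq_Omega co per.
split; first exact: omega_eq_Omega_equicontinuous.
move=> /equicontinuous_omega_eq_Omega oO; split.
  exact: omega_map_continuous.
exact: closure_periodic_core.
Qed.
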